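(* Let $A=IGL_{q,r}(N)$. Let $\Gamma$ be the left $A$-module freely generated by the symbols $\omega^i\equiv\omega_{a_1}{}^{a_2},\ \omega_0{}^{a_2}$ ($a_1,a_2=1,\dots,N$). Then $\Gamma$ is a bicovariant bimodule over $IGL_{q,r}(N)$ with right multiplication $$\omega^i a=(f^i{}_j*a)\,\omega^j,\qquad a\in IGL_{q,r}(N),$$ and with left and right actions of $IGL_{q,r}(N)$ on $\Gamma$ given by $$\Delta_L(a_i\omega^i)=\Delta(a_i)\,(I\otimes\omega^i),\qquad \Delta_R(a_i\omega^i)=\Delta(a_i)\,(\omega^j\otimes M_j{}^i),$$ where $f^i{}_j$ are the functionals on $IGL_{q,r}(N)$ induced by $$f_{A_1}{}^{a_2}{}_{B_1}{}^{b_2}=\kappa'(L^{+B_1}{}_{A_1})\,L^{-a_2}{}_{b_2},\qquad M^{B_1}{}_{b_2\,A_1}{}^{a_2}=T^{B_1}{}_{A_1}\,\kappa(T^{a_2}{}_{b_2})\in IGL_{q,r}(N),$$ with $A_1,B_1\in\{0,1,\dots,N\}$ and $a_2,b_2\in\{1,\dots,N\}$; here $f^i{}_j$ with $i={}_{A_1}{}^{a_2}$, $j={}_{B_1}{}^{b_2}$ stands for $f_{A_1}{}^{a_2}{}_{B_1}{}^{b_2}$, and $M_j{}^i$ for $M^{B_1}{}_{b_2A_1}{}^{a_2}$.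
   Context: Indices $A,B,\dots$ run over $\{0,1,\dots,N\}$, lower-case $a,b,\dots$ over $\{1,\dots,N\}$; repeated indices are summed. $r$ and $q_{AB}$ are nonzero complex parameters with $q_{AB}=r^2/q_{BA}$, $q_{AA}=r$. Let $\theta^{AB}=1$ for $A>B$ and $0$ otherwise, and $$R^{AB}{}_{CD}=\delta^A_C\delta^B_D\Big[\frac{r}{q_{AB}}+(r-1)\delta^{AB}\Big]+(r-r^{-1})\,\delta^A_D\delta^B_C\,\theta^{AB}.$$ $GL_{q,r}(N+1)$ is the unital $\mathbf C$-algebra generated by $T^A{}_B$ and the inverse $\Xi$ of the quantum determinant $$\det T=\sum_\sigma\Big[\prod_{A<B,\ \sigma(A)>\sigma(B)}\Big(-\frac{r^2}{q_{\sigma(B)\sigma(A)}}\Big)\Big]T^0{}_{\sigma(0)}\cdots T^N{}_{\sigma(N)},$$ modulo $R^{AB}{}_{EF}T^E{}_CT^F{}_D=T^B{}_FT^A{}_ER^{EF}{}_{CD}$; it is a Hopf algebra with $\Delta(T^A{}_B)=T^A{}_C\otimes T^C{}_B$, $\varepsilon(T^A{}_B)=\delta^A_B$, $\kappa(T)=T^{-1}$, $\Xi$ group-like. $IGL_{q,r}(N)$ is its quotient by the Hopf ideal $H$ generated by the $T^0{}_a$, with projection $P$; the images of $T^A{}_B$ are denoted by the same symbols (so $T^0{}_a=0$ in $IGL_{q,r}(N)$), and $\kappa,\Delta$ are its antipode and coproduct. The functionals $L^{\pm A}{}_B$ on $GL_{q,r}(N+1)$ are defined by $L^{+A}{}_B(T^C{}_D)=c^+R^{CA}{}_{DB}$,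 $L^{-A}{}_B(T^C{}_D)=c^-(R^{-1})^{AC}{}_{BD}$ ($c^\pm$ fixed nonzero complex numbers), $L^{\pm A}{}_B(I)=\delta^A_B$, $L^{\pm A}{}_B(ab)=L^{\pm A}{}_C(a)L^{\pm C}{}_B(b)$. Products of functionals are convolution products $\phi\psi=(\phi\otimes\psi)\Delta$, $\kappa'(\phi)=\phi\circ\kappa$ (antipode of $GL_{q,r}(N+1)$). The functionals $f_{A_1}{}^{a_2}{}_{B_1}{}^{b_2}$ above vanish on $H$, hence induce functionals on $IGL_{q,r}(N)$ by $f(P(a))=f(a)$. For a functional $f$, $f*a=(id\otimes f)\Delta(a)$. A bicovariant bimodule over a Hopf algebra $A$ is an $A$-bimodule $\Gamma$ with a left coaction $\Delta_L:\Gamma\to A\otimes\Gamma$ and a right coaction $\Delta_R:\Gamma\to\Gamma\otimes A$ satisfying $\Delta_L(a\rho b)=\Delta(a)\Delta_L(\rho)\Delta(b)$, $\Delta_R(a\rho b)=\Delta(a)\Delta_R(\rho)\Delta(b)$ and $(id\otimes\Delta_R)\Delta_L=(\Delta_L\otimes id)\Delta_R$. *)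

(* Defs.v *)
From HB Require Import structures.
From mathcomp Require Import all_boot all_order all_algebra perm generic_quotient ring_quotient.
From mathcomp Require Import boolp finmap monalg.

Set Implicit Arguments.
Unset Strict Implicit.
Unset Printing Implicit Defensive.
Import GRing.Theory.
Local Open Scope ring_scope.
Local Open Scope quotient_scope.

Section LinearQuotient.
Variables (K : fieldType) (V : lmodType K).

Record submodule := Submodule {
  submod_mem :> V -> Prop;
  submod0 : submod_mem 0;
  submodD : forall u v, submod_mem u -> submod_mem v -> submod_mem (u + v);
  submodZ : forall c u, submod_mem u -> submod_mem (c *: u) }.

Variable S : submodule.

Definition submod_pred : {pred V} := fun v => `[< S v >].

Lemma submod_pred_closed : zmod_closed submod_pred.
Proof.
split; first by apply/asboolP; exact: submod0.
move=> u v /asboolP Su /asboolP Sv; apply/asboolP; apply: submodD => //.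
by rewrite -scaleN1r; exact: submodZ.
Qed.
HB.instance Definition _ := GRing.isZmodClosed.Build V submod_pred submod_pred_closed.

Definition lquot : Type := (@Quotient.quot V submod_pred).
HB.instance Definition _ := GRing.Zmodule.on lquot.

Definition lproj : V -> lquot := \pi_(@Quotient.quot V submod_pred).
Definition lrepr : lquot -> V := @repr V (@Quotient.quot V submod_pred).

Lemma lreprK : cancel lrepr lproj. Proof. exact: reprK. Qed.

Lemma lprojP u v : lproj u = lproj v <-> S (u - v).
Proof.
split=> [/eqP|Suv]; first by rewrite -Quotient.idealrBE => /asboolP.
by apply/eqP; rewrite -Quotient.idealrBE; apply/asboolP.
Qed.

Lemma lprojB : {morph lproj : u v / u - v}.
Proof. exact: (raddfB (\pi_(@Quotient.quot V submod_pred))). Qed.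

Definition lquot_scale (c : K) (x : lquot) : lquot := lproj (c *: lrepr x).

Lemma lprojZ c u : lproj (c *: u) = lquot_scale c (lproj u).
Proof.
apply/lprojP; rewrite -scalerBr; apply: submodZ.
by apply/lprojP; rewrite lreprK.
Qed.

Lemma lprojD : {morph lproj : u v / u + v}.
Proof. exact: (raddfD (\pi_(@Quotient.quot V submod_pred))). Qed.

Lemma lquot_scaleA a b v : lquot_scale a (lquot_scale b v) = lquot_scale (a * b) v.
Proof. by rewrite -[v]lreprK -!lprojZ scalerA. Qed.
Lemma lquot_scale1 : left_id 1 lquot_scale.
Proof. by move=> v; rewrite -[v]lreprK -!lprojZ scale1r. Qed.
Lemma lquot_scaleDr : right_distributive lquot_scale +%R.
Proof.
by move=> a u v; rewrite -[u]lreprK -[v]lreprK -lprojD -!lprojZ -lprojD scalerDr.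
Qed.
Lemma lquot_scaleDl v : {morph lquot_scale^~ v : a b / a + b}.
Proof. by move=> a b; rewrite -[v]lreprK -!lprojZ -lprojD scalerDl. Qed.

HB.instance Definition _ := GRing.Zmodule_isLmodule.Build K lquot
  lquot_scaleA lquot_scale1 lquot_scaleDr lquot_scaleDl.

Lemma lproj_is_linear : linear lproj.
Proof. by move=> c u v; rewrite lprojD lprojZ. Qed.
HB.instance Definition _ := GRing.isLinear.Build K V lquot *:%R lproj lproj_is_linear.

End LinearQuotient.

Section Span.
Variables (K : fieldType) (V : lmodType K) (X : V -> Prop).

Inductive span_mem : V -> Prop :=
| span_gen v : X v -> span_mem v
| span_0 : span_mem 0
| span_D u v : span_mem u -> span_mem v -> span_mem (u + v)
| span_Z c u : span_mem u -> span_mem (c *: u).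

Definition span : submodule V := Submodule span_0 span_D span_Z.
End Span.

Section AlgebraQuotient.
Variables (K : fieldType) (A : algType K).

(* Proper because MathComp's algebras are nontrivial. *)
Record ideal := Ideal {
  ideal_submod :> submodule A;
  ideal_mull : forall a x, ideal_submod x -> ideal_submod (a * x);
  ideal_mulr : forall a x, ideal_submod x -> ideal_submod (x * a);
  ideal_proper : ~ ideal_submod 1 }.

Variable I : ideal.

Definition aquot : Type := lquot I.
HB.instance Definition _ := GRing.Lmodule.on aquot.

Definition aproj : A -> aquot := @lproj K A I.
HB.instance Definition _ := GRing.Linear.on aproj.

Definition aquot_mul (x y : aquot) : aquot := aproj (lrepr x * lrepr y).

Lemma aprojM : {morph aproj : a b / a * b >-> aquot_mul a b}.
Proof.
move=> a b; apply/lprojP.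
set a' := lrepr _; set b' := lrepr _.
have Ha : I (a - a') by apply/lprojP; rewrite lreprK.
have Hb : I (b - b') by apply/lprojP; rewrite lreprK.
rewrite -[a * b](subrK (a * b')) -addrA -mulrBr -mulrBl.
by apply: submodD; [exact: ideal_mull|exact: ideal_mulr].
Qed.

Lemma aproj_surj (x : aquot) : aproj (lrepr x) = x. Proof. exact: lreprK. Qed.

Lemma aquot_mulA : associative aquot_mul.
Proof.
move=> x y z; rewrite -[x]aproj_surj -[y]aproj_surj -[z]aproj_surj.
by rewrite -!aprojM mulrA.
Qed.
Lemma aquot_mul1l : left_id (aproj 1) aquot_mul.
Proof. by move=> x; rewrite -[x]aproj_surj -aprojM mul1r. Qed.
Lemma aquot_mul1r : right_id (aproj 1) aquot_mul.
Proof. by move=> x; rewrite -[x]aproj_surj -aprojM mulr1. Qed.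
Lemma aquot_mulDl : left_distributive aquot_mul +%R.
Proof.
move=> x y z; rewrite -[x]aproj_surj -[y]aproj_surj -[z]aproj_surj.
by rewrite -raddfD -!aprojM mulrDl raddfD.
Qed.
Lemma aquot_mulDr : right_distributive aquot_mul +%R.
Proof.
move=> x y z; rewrite -[x]aproj_surj -[y]aproj_surj -[z]aproj_surj.
by rewrite -raddfD -!aprojM mulrDr raddfD.
Qed.
Lemma aquot_1neq0 : aproj 1 != 0.
Proof.
apply/eqP; rewrite -[0](raddf0 aproj) => /lprojP; rewrite subr0.
exact: ideal_proper.
Qed.
HB.instance Definition _ := GRing.Zmodule_isNzRing.Build aquot
  aquot_mulA aquot_mul1l aquot_mul1r aquot_mulDl aquot_mulDr aquot_1neq0.

Lemma aproj_monoid_morphism : monoid_morphism aproj.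
Proof. by split => // a b; rewrite aprojM. Qed.
HB.instance Definition _ := GRing.isMonoidMorphism.Build A aquot aproj
  aproj_monoid_morphism.

Lemma aquot_scaleAl (c : K) (x y : aquot) : c *: (x * y) = c *: x * y.
Proof.
rewrite -[x]aproj_surj -[y]aproj_surj -rmorphM -!linearZ.
by rewrite -rmorphM scalerAl.
Qed.
HB.instance Definition _ := GRing.Lmodule_isLalgebra.Build K aquot aquot_scaleAl.

Lemma aquot_scaleAr (c : K) (x y : aquot) : c *: (x * y) = x * (c *: y).
Proof.
rewrite -[x]aproj_surj -[y]aproj_surj -rmorphM -!linearZ.
by rewrite -rmorphM scalerAr.
Qed.
HB.instance Definition _ := GRing.Lalgebra_isAlgebra.Build K aquot aquot_scaleAr.

End AlgebraQuotient.

Section IdealSpan.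
Variables (K : fieldType) (A : algType K) (X : A -> Prop).

Inductive ideal_mem : A -> Prop :=
| ideal_gen a : X a -> ideal_mem a
| ideal_0 : ideal_mem 0
| ideal_D a b : ideal_mem a -> ideal_mem b -> ideal_mem (a + b)
| ideal_Ml c a : ideal_mem a -> ideal_mem (c * a)
| ideal_Mr c a : ideal_mem a -> ideal_mem (a * c).

Lemma ideal_Z (c : K) a : ideal_mem a -> ideal_mem (c *: a).
Proof. by move=> Ia; rewrite -mulr_algl; exact: ideal_Ml. Qed.

Definition ideal_span_submod : submodule A := Submodule ideal_0 ideal_D ideal_Z.

Variable e : {rmorphism A -> K}.
Hypothesis eX : forall a, X a -> e a = 0.

Lemma ideal_mem_ker a : ideal_mem a -> e a = 0.
Proof.
elim=> [b /eX //||b c _ eb _ ec|c b _ eb|c b _ eb]; first exact: rmorph0.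
- by rewrite rmorphD eb ec addr0.
- by rewrite rmorphM eb mulr0.
- by rewrite rmorphM eb mul0r.
Qed.

Lemma ideal_span_proper : ~ ideal_mem 1.
Proof. by move/ideal_mem_ker/eqP; rewrite rmorph1 oner_eq0. Qed.

(* Two-sided ideal generated by [X]; the character [e] vanishing on [X] only
   serves to show that it is proper. *)
Definition ideal_span : ideal A :=
  @Ideal K A ideal_span_submod (fun c a => @ideal_Ml c a) (fun c a => @ideal_Mr c a)
    ideal_span_proper.

Definition aquot_char (x : aquot ideal_span) : K := e (lrepr x).

Lemma aquot_charE a : aquot_char (aproj ideal_span a) = e a.
Proof.
apply/eqP; rewrite -subr_eq0 -rmorphB; apply/eqP/ideal_mem_ker.
by apply/(lprojP ideal_span); rewrite lreprK.
Qed.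

Lemma aquot_char_zmod_morphism : zmod_morphism aquot_char.
Proof.
move=> x y; rewrite -[x]aproj_surj -[y]aproj_surj -raddfB !aquot_charE.
exact: rmorphB.
Qed.
HB.instance Definition _ := GRing.isZmodMorphism.Build (aquot ideal_span) K aquot_char
  aquot_char_zmod_morphism.
Lemma aquot_char_monoid_morphism : monoid_morphism aquot_char.
Proof.
split=> [|x y]; first by rewrite -(rmorph1 (aproj ideal_span)) aquot_charE rmorph1.
rewrite -[x]aproj_surj -[y]aproj_surj -rmorphM !aquot_charE; exact: rmorphM.
Qed.
HB.instance Definition _ := GRing.isMonoidMorphism.Build (aquot ideal_span) K aquot_char
  aquot_char_monoid_morphism.

End IdealSpan.

Section FreeAlgebra.
Variables (K : fieldType) (X : choiceType).

Definition freealg : Type := {malg K[{fmonom X}]}.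
HB.instance Definition _ := GRing.Lalgebra.on freealg.

Lemma freealg_scaleAr (c : K) (a b : freealg) : c *: (a * b) = a * (c *: b).
Proof.
have mulgC (g : freealg) : g * (c%:MP : {malg K[{fmonom X}]}) = c *: g.
  rewrite malgM_def fgmulgU malgZ_def; apply: eq_bigr => k _.
  by rewrite mulm1 mulrC.
by rewrite -[LHS]mulgC -mulrA mulgC.
Qed.
HB.instance Definition _ := GRing.Lalgebra_isAlgebra.Build K freealg freealg_scaleAr.

Definition freegen (x : X) : freealg := (<< fmu x >> : {malg K[{fmonom X}]}).

Variable h : X -> K.

Definition fmonom_eval (m : {fmonom X}) : K := \prod_(x <- m) h x.
Lemma fmonom_eval_mmorphism : mmorphism fmonom_eval.
Proof.
split=> [m1 m2|]; first by rewrite /fmonom_eval fmM big_cat.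
by rewrite /fmonom_eval fm1 big_nil.
Qed.
HB.instance Definition _ :=
  monalg.isMultiplicative.Build {fmonom X} K fmonom_eval fmonom_eval_mmorphism.

Definition freealg_char : freealg -> K := mmap idfun fmonom_eval.
Lemma freealg_char_zmod_morphism : zmod_morphism freealg_char.
Proof. exact: (raddfB (mmap (idfun : {rmorphism K -> K}) fmonom_eval)). Qed.
HB.instance Definition _ := GRing.isZmodMorphism.Build freealg K freealg_char
  freealg_char_zmod_morphism.
Lemma freealg_char_monoid_morphism : monoid_morphism freealg_char.
Proof.
split; first exact: (rmorph1 (mmap (idfun : {rmorphism K -> K}) fmonom_eval)).
exact: (rmorphM (mmap (idfun : {rmorphism K -> K}) fmonom_eval)).
Qed.
HB.instance Definition _ := GRing.isMonoidMorphism.Build freealg K freealg_char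
  freealg_char_monoid_morphism.

Lemma freealg_charE x : freealg_char (freegen x) = h x.
Proof.
by rewrite /freealg_char /freegen mmapU mul1r /fmonom_eval fmU big_seq1.
Qed.

Lemma freealg_charZ c a : freealg_char (c *: a) = c * freealg_char a.
Proof. exact: mmapZ. Qed.
End FreeAlgebra.

Section Tensor.
Variables (K : fieldType) (V W : lmodType K).

Let elem (v : V) (w : W) : {malg K[(V * W)%type]} := << (v, w) >>.

Inductive tensor_relator : {malg K[(V * W)%type]} -> Prop :=
| tensor_Dl v1 v2 w : tensor_relator (elem (v1 + v2) w - elem v1 w - elem v2 w)
| tensor_Dr v w1 w2 : tensor_relator (elem v (w1 + w2) - elem v w1 - elem v w2)
| tensor_Zl c v w : tensor_relator (elem (c *: v) w - c *: elem v w)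
| tensor_Zr c v w : tensor_relator (elem v (c *: w) - c *: elem v w).

Definition tensor : Type := lquot (span tensor_relator).
HB.instance Definition _ := GRing.Lmodule.on tensor.

Definition tens (v : V) (w : W) : tensor := lproj (span tensor_relator) (elem v w).

Lemma tens_bilinear : bilinear_for *:%R *:%R tens.
Proof.
split=> [w c v1 v2|v c w1 w2]; rewrite /tens -linearZ -linearD.
  apply/lprojP; set y := elem v1 w; set z := elem v2 w.
  rewrite (_ : _ - _ = (elem (c *: v1 + v2) w - elem (c *: v1) w - z)
                       + (elem (c *: v1) w - c *: y)); last first.
    by rewrite [X in _ = X + _]addrAC addrA subrK opprD addrA addrAC.
  by apply: span_D; apply: span_gen; [exact: tensor_Dl|exact: tensor_Zl].
apply/lprojP; set y := elem v w1; set z := elem v w2.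
rewrite (_ : _ - _ = (elem v (c *: w1 + w2) - elem v (c *: w1) - z)
                     + (elem v (c *: w1) - c *: y)); last first.
  by rewrite [X in _ = X + _]addrAC addrA subrK opprD addrA addrAC.
by apply: span_D; apply: span_gen; [exact: tensor_Dr|exact: tensor_Zr].
Qed.

Section Lift.
Variables (U : lmodType K) (b : V -> W -> U).

Definition tlift_free (g : {malg K[(V * W)%type]}) : U :=
  \sum_(k <- msupp g) g@_k *: b k.1 k.2.

Lemma tlift_freeEw (d : {fset (V * W)%type}) g :
  (msupp g `<=` d)%fset -> tlift_free g = \sum_(k <- d) g@_k *: b k.1 k.2.
Proof.
move=> le; rewrite [LHS](big_fset_incl _ le) => //= x xd /mcoeff_outdom ->.
by rewrite scale0r.
Qed.

Lemma tlift_free_linear : linear tlift_free.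
Proof.
move=> c g1 g2; set d := (msupp g1 `|` msupp g2 `|` msupp (c *: g1 + g2))%fset.
have s1 : (msupp g1 `<=` d)%fset by rewrite /d -fsetUA fsubsetUl.
have s2 : (msupp g2 `<=` d)%fset by rewrite /d fsetUAC fsubsetUr.
have s3 : (msupp (c *: g1 + g2) `<=` d)%fset by rewrite /d fsubsetUr.
rewrite (tlift_freeEw s1) (tlift_freeEw s2) (tlift_freeEw s3).
rewrite scaler_sumr -big_split; apply: eq_bigr => k _.
by rewrite mcoeffD mcoeffZ scalerDl scalerA.
Qed.
HB.instance Definition _ := GRing.isLinear.Build K _ U *:%R tlift_free tlift_free_linear.

Lemma tlift_freeU v w : tlift_free (elem v w) = b v w.
Proof. by rewrite (tlift_freeEw msuppU_le) big_seq_fset1 mcoeffUU scale1r. Qed.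

(* Linear map induced by a bilinear [b]; see [tlift_tens]. *)
Definition tlift (t : tensor) : U := tlift_free (lrepr t).

Hypothesis b_bilin : bilinear_for *:%R *:%R b.

Lemma tlift_proj g : tlift (lproj (span tensor_relator) g) = tlift_free g.
Proof.
apply/eqP; rewrite -subr_eq0 -linearB; apply/eqP.
have: span tensor_relator (lrepr (lproj (span tensor_relator) g) - g).
  by apply/lprojP; rewrite lreprK.
elim=> [x| |u v _ u0 _ v0|c u _ u0]; last first.
- by rewrite linearZ /= u0 scaler0.
- by rewrite linearD u0 v0 addr0.
- exact: linear0.
have [bl br] := b_bilin.
have bDl w v1 v2 : b (v1 + v2) w = b v1 w + b v2 w.
  by have /= := bl w 1 v1 v2; rewrite !scale1r.
have bDr v w1 w2 : b v (w1 + w2) = b v w1 + b v w2.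
  by have /= := br v 1 w1 w2; rewrite !scale1r.
have b0l w : b 0 w = 0 by apply: (addrI (b 0 w)); rewrite -bDl !addr0.
have b0r v : b v 0 = 0 by apply: (addrI (b v 0)); rewrite -bDr !addr0.
case=> [v1 v2 w|v w1 w2|c v w|c v w];
  rewrite !linearB /= ?linearZ /= !tlift_freeU.
- by rewrite bDl addrAC addrK subrr.
- by rewrite bDr addrAC addrK subrr.
- by have /= := bl w c v 0; rewrite !addr0 b0l addr0 => ->; rewrite scalerN subrr.
- by have /= := br v c w 0; rewrite !addr0 b0r addr0 => ->; rewrite scalerN subrr.
Qed.

Lemma tlift_tens v w : tlift (tens v w) = b v w.
Proof. by rewrite tlift_proj tlift_freeU. Qed.

Lemma tlift_linear : linear tlift.
Proof.
move=> c x y; rewrite -[x]lreprK -[y]lreprK -linearP !tlift_proj.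
exact: linearP.
Qed.

End Lift.
End Tensor.

Infix "\ox" := tens (at level 35, right associativity) : ring_scope.

Section TensorOperations.
Variable K : fieldType.

Definition tmap (V V' W W' : lmodType K) (f : V -> V') (g : W -> W')
    : tensor V W -> tensor V' W' :=
  tlift (fun v w => f v \ox g w).

(* (v1 (x) w1) (v2 (x) w2) = mu v1 v2 (x) nu w1 w2 *)
Definition tmul (V1 V2 V3 W1 W2 W3 : lmodType K)
    (mu : V1 -> V2 -> V3) (nu : W1 -> W2 -> W3)
    (x : tensor V1 W1) (y : tensor V2 W2) : tensor V3 W3 :=
  tlift (fun v1 w1 => tlift (fun v2 w2 => mu v1 v2 \ox nu w1 w2) y) x.

Definition tassoc (U V W : lmodType K) : tensor (tensor U V) W -> tensor U (tensor V W) :=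
  tlift (fun x w => tlift (fun u v => u \ox (v \ox w)) x).

End TensorOperations.

Section Hopf.
Variables (K : fieldType) (A : algType K).

Record hopf_structure := HopfStructure {
  comul : {linear A -> tensor A A};
  counit : {scalar A};
  antipode : {linear A -> A};
  comul1 : comul 1 = 1 \ox 1;
  comulM : forall a b, comul (a * b) = tmul *%R *%R (comul a) (comul b);
  counit1 : counit 1 = 1;
  counitM : forall a b, counit (a * b) = counit a * counit b;
  comulA : forall a, tassoc (tmap comul id (comul a)) = tmap id comul (comul a);
  counitl : forall a, tlift (fun x y => counit x *: y) (comul a) = a;
  counitr : forall a, tlift (fun x y => counit y *: x) (comul a) = a;
  antipodel : forall a, tlift (fun x y => antipode x * y) (comul a) = (counit a)%:A;
  antipoder : forall a, tlift (fun x y => x * antipode y) (comul a) = (counit a)%:A }.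

Variable H : hopf_structure.

(* Convolution: (phi (x) psi) Delta. *)
Definition conv (phi psi : A -> K) (a : A) : K :=
  tlift (fun x y => phi x * psi y : K^o) (comul H a).

(* f * a = (id (x) f) Delta(a) *)
Definition lconv (f : A -> K) (a : A) : A := tlift (fun x y => f y *: x) (comul H a).

Record bicovariant_bimodule (G : lmodType K) := BicovariantBimodule {
  lact : A -> G -> G;
  ract : G -> A -> G;
  coactL : {linear G -> tensor A G};
  coactR : {linear G -> tensor G A};
  lact_bilinear : bilinear_for *:%R *:%R lact;
  ract_bilinear : bilinear_for *:%R *:%R ract;
  lact1 : forall g, lact 1 g = g;
  lactM : forall a b g, lact (a * b) g = lact a (lact b g);
  ract1 : forall g, ract g 1 = g;
  ractM : forall g a b, ract g (a * b) = ract (ract g a) b;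
  lractA : forall a g b, ract (lact a g) b = lact a (ract g b);
  coactLA : forall g, tassoc (tmap (comul H) id (coactL g)) = tmap id coactL (coactL g);
  coactL_counit : forall g, tlift (fun a x => counit H a *: x) (coactL g) = g;
  coactRA : forall g, tassoc (tmap coactR id (coactR g)) = tmap id (comul H) (coactR g);
  coactR_counit : forall g, tlift (fun x a => counit H a *: x) (coactR g) = g;
  coactL_cov : forall a g b, coactL (ract (lact a g) b) =
    tmul *%R ract (tmul *%R lact (comul H a) (coactL g)) (comul H b);
  coactR_cov : forall a g b, coactR (ract (lact a g) b) =
    tmul ract *%R (tmul lact *%R (comul H a) (coactR g)) (comul H b);
  coactLR : forall g, tmap id coactR (coactL g) = tassoc (tmap coactL id (coactR g)) }.

End Hopf.

Record is_hopf_morphism (K : fieldType) (A B : algType K) (HA : hopf_structure A)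
    (HQ : hopf_structure B) (p : A -> B) : Prop := {
  hopf_comul : forall a, comul HQ (p a) = tmap p p (comul HA a);
  hopf_counit : forall a, counit HQ (p a) = counit HA a;
  hopf_antipode : forall a, antipode HQ (p a) = p (antipode HA a) }.

Section QuantumGroup.
Variables (K : fieldType) (N : nat) (r : K) (q : 'I_N.+1 -> 'I_N.+1 -> K).
Notation I := 'I_N.+1.

(* R^{AB}_{CD} is [Rmat A B C D]. *)
Definition Rmat (A B C D : I) : K :=
  ((A == C) && (B == D))%:R * (r / q A B + (r - 1) * (A == B)%:R)
  + (r - r^-1) * ((A == D) && (B == C))%:R * (B < A)%:R.

(* R as a linear map of K^(N+1) (x) K^(N+1), upper pair = row, lower pair = column. *)
Definition Rmx : 'M[K]_#|{: I * I}| := \matrix_(i, j)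
  Rmat (enum_val i).1 (enum_val i).2 (enum_val j).1 (enum_val j).2.

Definition Rinv (A B C D : I) : K := invmx Rmx (enum_rank (A, B)) (enum_rank (C, D)).

Definition qdet (A : algType K) (T : I -> I -> A) : A :=
  \sum_(s : {perm I})
    (\prod_(p : I * I | (p.1 < p.2)%N && (s p.2 < s p.1)%N)
        (- (r ^+ 2 / q (s p.2) (s p.1)))) *: \prod_(k < N.+1) T k (s k).

(* The generator [Some (A, B)] is T^A_B and [None] is the inverse of det T. *)
Definition GLgen : choiceType := option (I * I).
Definition GLfree := freealg K GLgen.
Definition Tfree (A B : I) : GLfree := freegen K (Some (A, B) : GLgen).
Definition Xifree : GLfree := freegen K (None : GLgen).

Inductive GL_relator : GLfree -> Prop :=
| GL_RTT A B C D : GL_relator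
    ((\sum_E \sum_F Rmat A B E F *: (Tfree E C * Tfree F D))
     - \sum_E \sum_F Rmat E F C D *: (Tfree B F * Tfree A E))
| GL_detl : GL_relator (qdet Tfree * Xifree - 1)
| GL_detr : GL_relator (Xifree * qdet Tfree - 1).

Definition GLcounit_gen (x : GLgen) : K := if x is Some AB then (AB.1 == AB.2)%:R else 1.

Lemma GLcounit_T A B : freealg_char GLcounit_gen (Tfree A B) = (A == B)%:R.
Proof. exact: freealg_charE. Qed.
Lemma GLcounit_Xi : freealg_char GLcounit_gen Xifree = 1.
Proof. exact: freealg_charE. Qed.

Lemma GLcounit_qdet : freealg_char GLcounit_gen (qdet Tfree) = 1.
Proof.
rewrite /qdet raddf_sum (bigD1 (1%g : {perm I})) //= [X in _ + X]big1 ?addr0.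
  rewrite freealg_charZ rmorph_prod big_pred0 ?mul1r; last first.
    by move=> p; rewrite !perm1; case: ltngtP.
  by rewrite big1 // => k _; rewrite /= GLcounit_T perm1 eqxx.
move=> s s1; rewrite freealg_charZ rmorph_prod.
have [k sk|/(_ _)/eqP sE] := pickP (fun k => s k != k).
  by rewrite (bigD1 k) //= GLcounit_T eq_sym (negbTE sk) mul0r mulr0.
by case/eqP: s1; apply/permP => k; rewrite perm1; apply/eqP; move: (sE k); case: eqP.
Qed.

Lemma GLcounit_sum (c : I -> I -> K) (u v : I -> I -> GLfree) :
  freealg_char GLcounit_gen (\sum_E \sum_F c E F *: (u E F * v E F)) =
  \sum_E \sum_F c E F * (freealg_char GLcounit_gen (u E F)
                          * freealg_char GLcounit_gen (v E F)).
Proof.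
rewrite rmorph_sum; apply: eq_bigr => E _ /=.
rewrite rmorph_sum; apply: eq_bigr => F _ /=.
by rewrite freealg_charZ rmorphM.
Qed.

Lemma GLcounit_relator a : GL_relator a -> freealg_char GLcounit_gen a = 0.
Proof.
case=> [A B C D| |]; last 2 first.
- by rewrite rmorphB rmorphM rmorph1 /= GLcounit_qdet GLcounit_Xi mulr1 subrr.
- by rewrite rmorphB rmorphM rmorph1 /= GLcounit_qdet GLcounit_Xi mulr1 subrr.
have e1 := GLcounit_sum (Rmat A B) (fun E _ => Tfree E C) (fun _ F => Tfree F D).
have e2 := GLcounit_sum (fun E F => Rmat E F C D) (fun _ F => Tfree B F) (fun E _ => Tfree A E).
rewrite rmorphB; apply/eqP; rewrite subr_eq0; apply/eqP.
apply: (etrans e1); apply/esym; apply: (etrans e2); apply/esym.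
transitivity (Rmat A B C D).
  rewrite (bigD1 C) //= [X in _ + X]big1 ?addr0 => [|E EC]; last first.
    by rewrite big1 // => F _; rewrite !GLcounit_T (negbTE EC) mul0r mulr0.
  rewrite (bigD1 D) //= [X in _ + X]big1 ?addr0 => [|F FD]; last first.
    by rewrite !GLcounit_T (negbTE FD) !mulr0.
  by rewrite !GLcounit_T !eqxx !mulr1.
rewrite (bigD1 A) //= [X in _ + X]big1 ?addr0 => [|E EA]; last first.
  by rewrite big1 // => F _; rewrite !GLcounit_T [A == E]eq_sym (negbTE EA) !mulr0.
rewrite (bigD1 B) //= [X in _ + X]big1 ?addr0 => [|F FB]; last first.
  by rewrite !GLcounit_T [B == F]eq_sym (negbTE FB) mul0r mulr0.
by rewrite !GLcounit_T !eqxx !mulr1.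
Qed.

(* GL_{q,r}(N+1). *)
Definition GLideal : ideal GLfree := ideal_span GLcounit_relator.
Definition GL : algType K := aquot GLideal.
Definition GL_T (A B : I) : GL := aproj GLideal (Tfree A B).
Definition GL_Xi : GL := aproj GLideal Xifree.

(* a in {1..N}, encoded by 'I_N, as an element of {0..N}. *)
Definition up (a : 'I_N) : I := lift ord0 a.

Inductive IGL_relator : GL -> Prop :=
| IGL_T0 a : IGL_relator (GL_T ord0 (up a)).

Lemma GLcounit_IGL_relator x :
  IGL_relator x -> @aquot_char _ _ _ _ GLcounit_relator x = 0.
Proof. by case=> a; rewrite aquot_charE; apply: etrans (GLcounit_T ord0 (up a)) _. Qed.

(* The ideal H, as the two-sided ideal generated by the T^0_a. *)
Definition IGLideal : ideal GL := ideal_span GLcounit_IGL_relator.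
Definition IGL : algType K := aquot IGLideal.
Definition IGL_P : GL -> IGL := aproj IGLideal.

Record is_GL_hopf (H : hopf_structure GL) : Prop := {
  GL_comulT : forall A B, comul H (GL_T A B) = \sum_C GL_T A C \ox GL_T C B;
  GL_counitT : forall A B, counit H (GL_T A B) = (A == B)%:R;
  GL_antipodeTl : forall A B, \sum_C antipode H (GL_T A C) * GL_T C B = (A == B)%:R;
  GL_antipodeTr : forall A B, \sum_C GL_T A C * antipode H (GL_T C B) = (A == B)%:R;
  GL_comulXi : comul H GL_Xi = GL_Xi \ox GL_Xi;
  GL_counitXi : counit H GL_Xi = 1 }.

(* [L A B] is L^A_B and [v A B C D] its value on T^C_D. *)
Record is_L_functional (v : I -> I -> I -> I -> K) (L : I -> I -> {scalar GL}) : Prop := {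
  L_T : forall A B C D, L A B (GL_T C D) = v A B C D;
  L_1 : forall A B, L A B 1 = (A == B)%:R;
  L_M : forall A B a b, L A B (a * b) = \sum_C L A C a * L C B b }.

(* The pair (A, a) is the index i = _A^a. *)
Definition Idx : finType := (I * 'I_N)%type.

(* kappa'(L^{+B1}_{A1}) L^{-a2}_{b2}, for i = _{A1}^{a2} and j = _{B1}^{b2}. *)
Definition f_GL (H : hopf_structure GL) (Lp Lm : I -> I -> {scalar GL}) (i j : Idx) : GL -> K :=
  conv H (fun x => Lp j.1 i.1 (antipode H x)) (Lm (up i.2) (up j.2)).

(* T^{B1}_{A1} kappa(T^{a2}_{b2}), for j = _{B1}^{b2} and i = _{A1}^{a2}. *)
Definition M_IGL (H : hopf_structure IGL) (j i : Idx) : IGL :=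
  IGL_P (GL_T j.1 i.1) * antipode H (IGL_P (GL_T (up i.2) (up j.2))).

(* Free left IGL-module on the symbols omega^i. *)
Definition Gamma : lmodType K := {ffun Idx -> IGL}.
Definition Gamma_lact (a : IGL) (g : Gamma) : Gamma := [ffun i => a * (g : {ffun Idx -> IGL}) i].
Definition omega (i : Idx) : Gamma := [ffun j => (i == j)%:R].

End QuantumGroup.

(* Main.v *)
(** The symbols [omega^i] freely generate the left module, so all structure maps
    are determined by their values on them.  By Woronowicz's criterion they form a
    bicovariant bimodule as soon as
    - [f^i_j (a b) = f^i_k (a) f^k_j (b)] (right action),
    - [Delta (M_j^i) = M_j^k (x) M_k^i] (right coaction),
    - [(f^i_j * a) M_l^j = M_k^i (a * f^k_l)] (compatibility of the two).
    For the third condition, the RTT relations say that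
    [T^A_F (L^F_B * a) = (a * L^A_F) T^F_B] for [L = L^+, L^-] and [a = T^C_D]; the set
    of [a] with this property is a subalgebra closed under inverses, hence everything.
    Composing with the antipode turns it into
    [T^K_A (a * kappa' L^L_K) = (kappa' L^B_A * a) T^L_B] and
    [kappa (T^a_c) (a * L^c_b) = (L^a_c * a) kappa (T^c_b)], which combine to the third
    condition with all indices in [0..N].  It descends to [IGL] and to indices
    [a_2, b_2 > 0] because [T^0_a] dies there and [L^(-0)_b = 0] for [b > 0]. *)

Require Import Defs.
From HB Require Import structures.
From mathcomp Require Import all_boot all_order all_algebra perm.
From mathcomp Require Import reals complex.
From mathcomp Require Import monalg ring.

Set Implicit Arguments.
Unset Strict Implicit.
Unset Printing Implicit Defensive.
Import GRing.Theory.
Local Open Scope ring_scope.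
Local Open Scope complex_scope.

(** The values of the functionals at the inverse determinant, and the behaviour of the antipode on
    products and on coproducts of matrix entries, are not part of the data; they have to be derived.
    The antipode reverses products, which makes $f$ multiplicative, and reverses the coproduct of
    matrix coefficients, which makes $M$ a corepresentation. The relation between $T$ and $L^\pm$ is
    stable under products because $a\mapsto L*a$ and $a\mapsto a*L$ are algebra maps into matrices
    over the algebra. It is then inverted on two different sides: for $L^+$ the functional is
    inverted, $\kappa' L^+$ being the convolution inverse of $L^+$; for $L^-$ the matrix $T$ is
    inverted. Before anything can live on [IGL], the $f$ must vanish on $H$. Their common kernel is
    an ideal by multiplicativity, so only the $T^0{}_c$ matter. There $L^+\circ\kappa$ vanishes
    because the row $R^{0A}$ has just one nonzero entry, on the diagonal, while the remaining factor
    $L^-(T^0{}_c)$ is an entry of $R^{-1}$ that is zero when $b_2>0$. *)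

Local Notation bilin b := (bilinear_for *:%R *:%R b).

(** * Linear and bilinear maps, tensor products *)

Section Linear.
Variable K : fieldType.
Implicit Types U V W X : lmodType K.

Lemma linD V U (f : V -> U) : linear f -> {morph f : x y / x + y}.
Proof. by move=> lf x y; rewrite -{1}[x]scale1r lf scale1r. Qed.

Lemma lin0 V U (f : V -> U) : linear f -> f 0 = 0.
Proof. by move=> lf; apply: (addrI (f 0)); rewrite -(linD lf) !addr0. Qed.

Lemma linZ V U (f : V -> U) : linear f -> forall c, {morph f : x / c *: x}.
Proof. by move=> lf c x; rewrite -[c *: x]addr0 lf (lin0 lf) addr0. Qed.

Lemma lin_sum V U (f : V -> U) (J : finType) (F : J -> V) :
  linear f -> f (\sum_j F j) = \sum_j f (F j).
Proof. by move=> lf; apply: big_morph; [exact: linD | exact: lin0]. Qed.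

Lemma lin_id V : linear (fun x : V => x). Proof. by []. Qed.

Lemma lin_comp U V W (f : V -> W) (g : U -> V) :
  linear f -> linear g -> linear (fun x => f (g x)).
Proof. by move=> lf lg c x y; rewrite lg lf. Qed.

Lemma lin_eq U V (f g : U -> V) : f =1 g -> linear g -> linear f.
Proof. by move=> fg lg c x y; rewrite !fg lg. Qed.

Lemma lin_add U V (f g : U -> V) :
  linear f -> linear g -> linear (fun x => f x + g x).
Proof. by move=> lf lg c x y; rewrite lf lg scalerDr addrACA. Qed.

Lemma lin_bigsum U V (J : finType) (F : J -> U -> V) :
  (forall j, linear (F j)) -> linear (fun x => \sum_j F j x).
Proof.
move=> lF c x y; rewrite scaler_sumr -big_split; apply: eq_bigr => j _.
exact: lF.
Qed.

Lemma bilin_l U V W (b : U -> V -> W) v : bilin b -> linear (b^~ v).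
Proof. by case=> h _; exact: h. Qed.

Lemma bilin_r U V W (b : U -> V -> W) u : bilin b -> linear (b u).
Proof. by case=> _; apply. Qed.

Lemma bilin_comp U U' V V' W (b : U -> V -> W) (f : U' -> U) (g : V' -> V) :
  bilin b -> linear f -> linear g -> bilin (fun x y => b (f x) (g y)).
Proof.
move=> bb lf lg; split=> [w|v].
- exact: (lin_comp (bilin_l _ bb) lf).
- exact: (lin_comp (bilin_r _ bb) lg).
Qed.

Lemma bilin_post U V W W' (f : W -> W') (b : U -> V -> W) :
  linear f -> bilin b -> bilin (fun x y => f (b x y)).
Proof.
move=> lf bb; split=> [w|v].
- exact: (lin_comp lf (bilin_l _ bb)).
- exact: (lin_comp lf (bilin_r _ bb)).
Qed.

Lemma bilin_bigsum U V W (J : finType) (b : J -> U -> V -> W) :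
  (forall j, bilin (b j)) -> bilin (fun x y => \sum_j b j x y).
Proof.
by move=> bb; split=> [w|v]; apply: lin_bigsum => j; [apply: bilin_l|apply: bilin_r].
Qed.

Lemma bilin_swap U V W (b : U -> V -> W) : bilin b -> bilin (fun x y => b y x).
Proof. by case=> bl br; split. Qed.

Lemma mul_bilin (A : algType K) : bilin (@GRing.mul A).
Proof.
split=> z c x y; last by rewrite /= mulrDr scalerAr.
by rewrite /= mulrDl scalerAl.
Qed.

Lemma scale_bilin U : bilin (fun (c : K^o) (u : U) => c *: u).
Proof.
split=> [u c x y|c d x y] /=; first by rewrite scalerDl scalerA.
by rewrite scalerDr !scalerA mulrC.
Qed.

Lemma tens_bilin V W : bilin (@tens K V W).
Proof. exact: tens_bilinear. Qed.

(** Compute $YXZ$ with both bracketings. The product is an arbitrary associative bilinear [m]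
    because the use is in [tensor A A], whose product is the function [tmul] and not a ring
    multiplication. *)
Lemma bilin_inverse_unique V (m : V -> V -> V) (one : V) (J : finType)
    (X Y Z : J -> J -> V) :
  bilin m -> (forall x y z, m (m x y) z = m x (m y z)) ->
  (forall x, m x one = x) -> (forall x, m one x = x) ->
  (forall i j, \sum_k m (Y i k) (X k j) = (i == j)%:R *: one) ->
  (forall i j, \sum_k m (X i k) (Z k j) = (i == j)%:R *: one) ->
  forall i j, Y i j = Z i j.
Proof.
move=> bm mA m1 lm YX XZ i j.
have E1 k : \sum_l m (Y i k) (m (X k l) (Z l j)) = (k == j)%:R *: Y i k.
  rewrite -(lin_sum (fun l => m (X k l) (Z l j)) (bilin_r (Y i k) bm)) XZ.
  by rewrite (linZ (bilin_r _ bm)) m1.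
have E2 l : \sum_k m (Y i k) (m (X k l) (Z l j)) = (i == l)%:R *: Z l j.
  under eq_bigr do rewrite -mA.
  rewrite -(lin_sum (fun k => m (Y i k) (X k l)) (bilin_l (Z l j) bm)) YX.
  by rewrite (linZ (bilin_l _ bm)) lm.
transitivity (\sum_k \sum_l m (Y i k) (m (X k l) (Z l j))).
  under eq_bigr do rewrite E1.
  rewrite (bigD1 j) //= eqxx scale1r big1 ?addr0 // => k /negPf ->.
  exact: scale0r.
rewrite exchange_big /=; under eq_bigr do rewrite E2.
rewrite (bigD1 i) //= eqxx scale1r big1 ?addr0 // => k.
by rewrite eq_sym => /negPf ->; exact: scale0r.
Qed.

End Linear.

Lemma malgUZ (K : fieldType) (X : choiceType) (c : K) (x : X) :
  << c *g x >> = c *: << x >> :> {malg K[X]}.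
Proof. by apply/malgP => y; rewrite mcoeffZ !mcoeffU mulrnAr mulr1. Qed.

Section TensorCalculus.
Variable K : fieldType.
Implicit Types U V W X : lmodType K.

(** A representative is a finite combination of pairs, and a coefficient can be absorbed into the
    left component; hence closure under sums is enough. *)
Lemma tens_ind V W (P : tensor V W -> Prop) :
  (forall v w, P (v \ox w)) -> (forall x y, P x -> P y -> P (x + y)) ->
  forall t, P t.
Proof.
move=> Pt PD t; rewrite -[t]lreprK; set g := lrepr t.
have P0 : P 0 by rewrite -(lin0 (bilin_l 0 (tens_bilin V W))); exact: Pt.
rewrite [g]monalgE raddf_sum; apply: (big_ind P) => // -[v w] _.
rewrite malgUZ /= linearZ /= -[lproj _ _]/(v \ox w).
by rewrite -(linZ (bilin_l w (tens_bilin V W))); exact: Pt.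
Qed.

Lemma tens_ext V W U (f g : tensor V W -> U) :
  linear f -> linear g -> (forall v w, f (v \ox w) = g (v \ox w)) -> f =1 g.
Proof.
move=> lf lg fg; apply: tens_ind => // x y fx fy.
by rewrite (linD lf) (linD lg) fx fy.
Qed.

Lemma tlift_eq V W U (b b' : V -> W -> U) t :
  bilin b -> bilin b' -> (forall v w, b v w = b' v w) -> tlift b t = tlift b' t.
Proof.
move=> bb bb' e; apply: (tens_ext (tlift_linear bb) (tlift_linear bb')) => v w.
by rewrite !tlift_tens.
Qed.

Lemma lin_tlift V W U U' (h : U -> U') (b : V -> W -> U) t :
  linear h -> bilin b -> h (tlift b t) = tlift (fun v w => h (b v w)) t.
Proof.
move=> lh bb; have bhb := bilin_post lh bb.
apply: (tens_ext (lin_comp lh (tlift_linear bb)) (tlift_linear bhb)) => v w.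
by rewrite !tlift_tens.
Qed.

(** Induction on [t]: on a pure tensor [tlift (b x)] is just [b x v w]. This supplies linearity in
    the outer variable of the nested lifts [tmul] and [tassoc]. *)
Lemma lin_tlift_fun V W X U (b : X -> V -> W -> U) t :
  (forall x, bilin (b x)) -> (forall v w, linear (fun x => b x v w)) ->
  linear (fun x => tlift (b x) t).
Proof.
move=> bb lb; elim/tens_ind: t => [v w|t t' lt lt'].
  exact: lin_eq (fun x => tlift_tens (bb x) v w) (lb v w).
by apply: lin_eq (fun x => linD (tlift_linear (bb x)) t t') _; exact: (lin_add lt lt').
Qed.

Lemma tmap_bilin V V' W W' (f : V -> V') (g : W -> W') :
  linear f -> linear g -> bilin (fun v w => f v \ox g w).
Proof. by move=> lf lg; apply: bilin_comp => //; exact: tens_bilin. Qed.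

Lemma tmap_linear V V' W W' (f : V -> V') (g : W -> W') :
  linear f -> linear g -> linear (tmap f g).
Proof. by move=> lf lg; apply/tlift_linear/tmap_bilin. Qed.

Lemma tmap_tens V V' W W' (f : V -> V') (g : W -> W') v w :
  linear f -> linear g -> tmap f g (v \ox w) = f v \ox g w.
Proof. by move=> lf lg; rewrite /tmap tlift_tens //; exact: tmap_bilin. Qed.

Lemma tlift_tmap V V' W W' U (b : V' -> W' -> U) (f : V -> V') (g : W -> W') t :
  bilin b -> linear f -> linear g ->
  tlift b (tmap f g t) = tlift (fun v w => b (f v) (g w)) t.
Proof.
move=> bb lf lg; rewrite /tmap (lin_tlift _ (tlift_linear bb) (tmap_bilin lf lg)).
apply: tlift_eq => [||v w]; last by rewrite tlift_tens.
  by apply: bilin_post; [exact: tlift_linear|exact: tmap_bilin].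
exact: bilin_comp.
Qed.

Lemma tmap_comp V V' V'' W W' W'' (f' : V' -> V'') (g' : W' -> W'')
    (f : V -> V') (g : W -> W') t :
  linear f -> linear g -> linear f' -> linear g' ->
  tmap f' g' (tmap f g t) = tmap (fun v => f' (f v)) (fun w => g' (g w)) t.
Proof. by move=> *; rewrite {1}/tmap tlift_tmap //; exact: tmap_bilin. Qed.

Lemma tassoc_bilin1 U V W (w : W) :
  bilin (fun (u : U) (v : V) => u \ox (v \ox w)).
Proof.
apply: (bilin_comp (tens_bilin _ _)) => //; exact: (bilin_l _ (tens_bilin _ _)).
Qed.

Lemma tassoc_bilin U V W :
  bilin (fun (x : tensor U V) (w : W) => tlift (fun u v => u \ox (v \ox w)) x).
Proof.
split=> [w|x]; first exact/tlift_linear/tassoc_bilin1.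
apply: lin_tlift_fun => [w|u v]; first exact: tassoc_bilin1.
exact: (lin_comp (bilin_r u (tens_bilin _ _)) (bilin_r v (tens_bilin _ _))).
Qed.

Lemma tassoc_linear U V W : linear (@tassoc K U V W).
Proof. exact/tlift_linear/tassoc_bilin. Qed.

Lemma tassoc_tens U V W (u : U) (v : V) (w : W) :
  tassoc ((u \ox v) \ox w) = u \ox (v \ox w).
Proof.
by rewrite /tassoc !tlift_tens //; [exact: tassoc_bilin1|exact: tassoc_bilin].
Qed.

Lemma tens3_ext U V W X (f g : tensor (tensor U V) W -> X) :
  linear f -> linear g ->
  (forall u v w, f ((u \ox v) \ox w) = g ((u \ox v) \ox w)) -> f =1 g.
Proof.
move=> lf lg e; apply: tens_ext => // z w.
have lw h : linear h -> linear (fun z : tensor U V => h (z \ox w) : X).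
  by move=> lh; exact: (lin_comp lh (bilin_l w (tens_bilin _ _))).
exact: (tens_ext (lw f lf) (lw g lg)).
Qed.

End TensorCalculus.

(** * Componentwise products of tensors *)

Section TensorProducts.
Variable K : fieldType.

Section Basics.
Variables V1 V2 V3 W1 W2 W3 : lmodType K.
Variables (mu : V1 -> V2 -> V3) (nu : W1 -> W2 -> W3).
Hypotheses (bmu : bilin mu) (bnu : bilin nu).

Lemma tmul_bilin2 v1 w1 : bilin (fun v2 w2 => mu v1 v2 \ox nu w1 w2).
Proof. exact: (tmap_bilin (bilin_r v1 bmu) (bilin_r w1 bnu)). Qed.

Lemma tmul_bilin1 y :
  bilin (fun v1 w1 => tlift (fun v2 w2 => mu v1 v2 \ox nu w1 w2) y).
Proof.
split=> [w1|v1]; apply: lin_tlift_fun => [?|v2 w2]; try exact: tmul_bilin2.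
  exact: (bilin_l _ (tmap_bilin (bilin_l v2 bmu) (bilin_l w2 bnu))).
exact: (bilin_r _ (tmap_bilin (bilin_l v2 bmu) (bilin_l w2 bnu))).
Qed.

Lemma tmul_bilin : bilin (tmul mu nu).
Proof.
split=> [y|x]; first exact/tlift_linear/tmul_bilin1.
apply: lin_tlift_fun => [y|v1 w1]; first exact: tmul_bilin1.
exact/tlift_linear/tmul_bilin2.
Qed.

Lemma tmul_tens v1 w1 v2 w2 :
  tmul mu nu (v1 \ox w1) (v2 \ox w2) = mu v1 v2 \ox nu w1 w2.
Proof. by rewrite /tmul !tlift_tens //; [exact: tmul_bilin2|exact: tmul_bilin1]. Qed.

Lemma tmul_ext (U : lmodType K) (b b' : tensor V1 W1 -> tensor V2 W2 -> U) :
  bilin b -> bilin b' ->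
  (forall v1 w1 v2 w2, b (v1 \ox w1) (v2 \ox w2) = b' (v1 \ox w1) (v2 \ox w2)) ->
  forall x y, b x y = b' x y.
Proof.
move=> bb bb' e x y; apply: (tens_ext (bilin_l y bb) (bilin_l y bb')) => v1 w1 /=.
apply: (tens_ext (bilin_r _ bb) (bilin_r _ bb')) => v2 w2; exact: e.
Qed.

End Basics.

(** Eight independent products are allowed so that the same law covers the algebra [tensor A A] and
    its left and right actions on [tensor A G] and [tensor G A]. *)
Lemma tmulA (V1 V2 V3 V12 V23 V W1 W2 W3 W12 W23 W : lmodType K)
    (m12 : V1 -> V2 -> V12) (m12_3 : V12 -> V3 -> V)
    (m23 : V2 -> V3 -> V23) (m1_23 : V1 -> V23 -> V)
    (n12 : W1 -> W2 -> W12) (n12_3 : W12 -> W3 -> W)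
    (n23 : W2 -> W3 -> W23) (n1_23 : W1 -> W23 -> W) :
  bilin m12 -> bilin m12_3 -> bilin m23 -> bilin m1_23 ->
  bilin n12 -> bilin n12_3 -> bilin n23 -> bilin n1_23 ->
  (forall a b c, m12_3 (m12 a b) c = m1_23 a (m23 b c)) ->
  (forall a b c, n12_3 (n12 a b) c = n1_23 a (n23 b c)) ->
  forall x y z, tmul m12_3 n12_3 (tmul m12 n12 x y) z
              = tmul m1_23 n1_23 x (tmul m23 n23 y z).
Proof.
move=> b1 b2 b3 b4 c1 c2 c3 c4 mA nA x y z.
have B1 := tmul_bilin b1 c1; have B2 := tmul_bilin b2 c2.
have B3 := tmul_bilin b3 c3; have B4 := tmul_bilin b4 c4.
elim/tens_ind: z => [v3 w3|z z' e e']; last first.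
  by rewrite (linD (bilin_r _ B2)) (linD (bilin_r _ B3)) (linD (bilin_r _ B4)) e e'.
move: x y; apply: tmul_ext => [||v1 w1 v2 w2].
- exact: (bilin_post (bilin_l _ B2) B1).
- exact: (bilin_comp B4 (@lin_id _ _) (bilin_l _ B3)).
- by rewrite !tmul_tens // mA nA.
Qed.

Lemma tmap_tmul (V1 V2 V3 W1 W2 W3 V1' V2' V3' W1' W2' W3' : lmodType K)
    (mu : V1 -> V2 -> V3) (nu : W1 -> W2 -> W3)
    (mu' : V1' -> V2' -> V3') (nu' : W1' -> W2' -> W3')
    f1 f2 f3 g1 g2 g3 :
  bilin mu -> bilin nu -> bilin mu' -> bilin nu' ->
  linear f1 -> linear f2 -> linear f3 -> linear g1 -> linear g2 -> linear g3 ->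
  (forall v1 v2, f3 (mu v1 v2) = mu' (f1 v1) (f2 v2)) ->
  (forall w1 w2, g3 (nu w1 w2) = nu' (g1 w1) (g2 w2)) ->
  forall x y, tmap f3 g3 (tmul mu nu x y) = tmul mu' nu' (tmap f1 g1 x) (tmap f2 g2 y).
Proof.
move=> b c b' c' lf1 lf2 lf3 lg1 lg2 lg3 fM gM.
apply: tmul_ext => [||v1 w1 v2 w2].
- by apply: bilin_post; [exact: tmap_linear|exact: tmul_bilin].
- by apply: bilin_comp; [exact: tmul_bilin|exact: tmap_linear..].
- by rewrite !tmul_tens ?tmap_tens ?tmul_tens // fM gM.
Qed.

Lemma tlift_tmul (V1 V2 V3 W1 W2 W3 U1 U2 U3 : lmodType K)
    (mu : V1 -> V2 -> V3) (nu : W1 -> W2 -> W3) (xi : U1 -> U2 -> U3)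
    (b1 : V1 -> W1 -> U1) (b2 : V2 -> W2 -> U2) (b3 : V3 -> W3 -> U3) :
  bilin mu -> bilin nu -> bilin xi -> bilin b1 -> bilin b2 -> bilin b3 ->
  (forall v1 w1 v2 w2, b3 (mu v1 v2) (nu w1 w2) = xi (b1 v1 w1) (b2 v2 w2)) ->
  forall x y, tlift b3 (tmul mu nu x y) = xi (tlift b1 x) (tlift b2 y).
Proof.
move=> bmu bnu bxi bb1 bb2 bb3 bM; apply: tmul_ext => [||v1 w1 v2 w2].
- by apply: bilin_post; [exact: tlift_linear|exact: tmul_bilin].
- by apply: bilin_comp => //; exact: tlift_linear.
- by rewrite tmul_tens // !tlift_tens // bM.
Qed.

Lemma tassoc_tmul (U1 U2 U3 V1 V2 V3 W1 W2 W3 : lmodType K)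
    (la : U1 -> U2 -> U3) (mu : V1 -> V2 -> V3) (nu : W1 -> W2 -> W3) :
  bilin la -> bilin mu -> bilin nu ->
  forall x y, tassoc (tmul (tmul la mu) nu x y)
            = tmul la (tmul mu nu) (tassoc x) (tassoc y).
Proof.
move=> bla bmu bnu; have bl := tmul_bilin bla bmu; have br := tmul_bilin bmu bnu.
have br' := tmul_bilin bla br.
have lin_tassoc (U V W : lmodType K) (w : W) : linear (fun z : tensor U V => tassoc (z \ox w)).
  exact: (lin_comp (@tassoc_linear K U V W) (bilin_l w (tens_bilin _ _))).
apply: tmul_ext => [||x w1 y w2].
- by apply: bilin_post; [exact: tassoc_linear|exact: tmul_bilin].
- by apply: bilin_comp; [exact: tmul_bilin|exact: tassoc_linear..].
rewrite tmul_tens //; move: x y; apply: tmul_ext => [||u1 v1 u2 v2].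
- exact: (bilin_post (lin_tassoc _ _ _ (nu w1 w2)) bl).
- exact: (bilin_comp br' (lin_tassoc _ _ _ w1) (lin_tassoc _ _ _ w2)).
by rewrite tmul_tens // !tassoc_tens !tmul_tens.
Qed.

End TensorProducts.

(** * Convolution with functionals *)

Section ScalarContraction.
Variable K : fieldType.
Implicit Types U V W : lmodType K.

Lemma scale_l_bilin U V (f : V -> K) :
  linear (f : V -> K^o) -> bilin (fun (x : V) (u : U) => f x *: u).
Proof.
by move=> lf; split=> [u c x y|x c u v] /=;
  rewrite ?lf ?scalerDl ?scalerDr !scalerA // mulrC.
Qed.

Lemma scale_r_bilin U V (f : V -> K) :
  linear (f : V -> K^o) -> bilin (fun (u : U) (x : V) => f x *: u).
Proof. by move=> lf; exact: (bilin_swap (scale_l_bilin _ lf)). Qed.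

(** This and the next two lemmas contract the last, the first and the middle factor of a triple
    tensor. Applied to the iterated coproduct they turn coassociativity into [comul_lconv],
    [comul_rconv] and [tmap_rconv]. *)
Lemma tassoc_scale_r U V W (f : W -> K) (lf : linear (f : W -> K^o))
    (t : tensor (tensor U V) W) :
  tmap id (tlift (fun x y => f y *: x)) (tassoc t) = tlift (fun z y => f y *: z) t.
Proof.
have b := scale_r_bilin V lf; have lb := tlift_linear b.
have b' := scale_r_bilin (tensor U V) lf.
have lr := lin_comp (tmap_linear (@lin_id _ U) lb) (@tassoc_linear _ U V W).
move: t; apply: (tens3_ext lr (tlift_linear b')) => x y z.
rewrite tassoc_tens (tmap_tens _ _ (@lin_id _ U) lb) (tlift_tens b) (tlift_tens b').
by rewrite (linZ (bilin_r x (tens_bilin _ _))).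
Qed.

Lemma tassoc_scale_l U V W (f : U -> K) (lf : linear (f : U -> K^o))
    (t : tensor (tensor U V) W) :
  tlift (fun y z => f y *: z) (tassoc t) = tmap (tlift (fun x y => f x *: y)) id t.
Proof.
have b := scale_l_bilin V lf; have lb := tlift_linear b.
have b' := scale_l_bilin (tensor V W) lf.
have lr := lin_comp (tlift_linear b') (@tassoc_linear _ U V W).
move: t; apply: (tens3_ext lr (tmap_linear lb (@lin_id _ W))) => x y z.
rewrite tassoc_tens (tmap_tens _ _ lb (@lin_id _ W)) (tlift_tens b) (tlift_tens b').
by rewrite (linZ (bilin_l z (tens_bilin _ _))).
Qed.

Lemma tassoc_scale_m U V W (f : V -> K) (lf : linear (f : V -> K^o))
    (t : tensor (tensor U V) W) :
  tmap id (tlift (fun x y => f x *: y)) (tassoc t)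
  = tmap (tlift (fun x y => f y *: x)) id t.
Proof.
have b := scale_l_bilin W lf; have lb := tlift_linear b.
have b' := scale_r_bilin U lf; have lb' := tlift_linear b'.
have lr := lin_comp (tmap_linear (@lin_id _ U) lb) (@tassoc_linear _ U V W).
move: t; apply: (tens3_ext lr (tmap_linear lb' (@lin_id _ W))) => x y z.
rewrite tassoc_tens (tmap_tens _ _ (@lin_id _ U) lb) (tmap_tens _ _ lb' (@lin_id _ W)).
rewrite (tlift_tens b) (tlift_tens b') (linZ (bilin_r x (tens_bilin _ _))).
by rewrite (linZ (bilin_l z (tens_bilin _ _))).
Qed.

End ScalarContraction.

Section Convolution.
Variables (K : fieldType) (A : algType K) (H : hopf_structure A).
Local Notation D := (comul H).
Local Notation eps := (counit H).
Local Notation kap := (antipode H).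

Lemma scalar_linear (f : {scalar A}) : linear (f : A -> K^o).
Proof. exact: linearP. Qed.

(** Written $a*f$ in the overview; the mirror image of [lconv]. *)
Definition rconv (f : A -> K) (a : A) : A := tlift (fun x y => f x *: y) (D a).

Lemma lconv_linear (f : {scalar A}) : linear (lconv H f).
Proof. exact: (lin_comp (tlift_linear (scale_r_bilin _ (scalar_linear f))) (linearP D)). Qed.

Lemma rconv_linear (f : {scalar A}) : linear (rconv f).
Proof. exact: (lin_comp (tlift_linear (scale_l_bilin _ (scalar_linear f))) (linearP D)). Qed.

(** By coassociativity both sides are $a_1\otimes a_2\,f(a_3)$. *)
Lemma comul_lconv (f : {scalar A}) a : D (lconv H f a) = tmap id (lconv H f) (D a).
Proof.
have lD := linearP D; have bf := scale_r_bilin A (scalar_linear f); have lf := tlift_linear bf.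
have bs : bilin (fun (z : tensor A A) y => f y *: z).
  exact: scale_r_bilin _ (scalar_linear f).
rewrite /lconv (lin_tlift _ lD bf).
transitivity (tlift (fun z y => f y *: z) (tmap D id (D a))).
  rewrite (tlift_tmap _ bs lD (@lin_id _ _)).
  apply: tlift_eq (bilin_post lD bf) (bilin_comp bs lD (@lin_id _ _)) _ => x y.
  exact: (linZ lD).
rewrite -[RHS](tmap_comp _ (@lin_id _ _) lD (@lin_id _ _) lf) -comulA.
exact: esym (tassoc_scale_r (scalar_linear f) _).
Qed.

Lemma comul_rconv (f : {scalar A}) a : D (rconv f a) = tmap (rconv f) id (D a).
Proof.
have lD := linearP D; have bf := scale_l_bilin A (scalar_linear f); have lf := tlift_linear bf.
have bs : bilin (fun y (z : tensor A A) => f y *: z).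
  exact: scale_l_bilin _ (scalar_linear f).
rewrite /rconv (lin_tlift _ lD bf).
transitivity (tlift (fun y z => f y *: z) (tmap id D (D a))).
  rewrite (tlift_tmap _ bs (@lin_id _ _) lD).
  apply: tlift_eq (bilin_post lD bf) (bilin_comp bs (@lin_id _ _) lD) _ => x y.
  exact: (linZ lD).
rewrite -[RHS](tmap_comp _ lD (@lin_id _ _) lf (@lin_id _ _)) -comulA.
exact: (tassoc_scale_l (scalar_linear f)).
Qed.

(** Both sides are $a_1 f(a_2)\otimes a_3$. This moves a functional from the second tensor factor to
    the first, as the covariance of the right coaction requires. *)
Lemma tmap_rconv (f : {scalar A}) a :
  tmap id (rconv f) (D a) = tmap (lconv H f) id (D a).
Proof.
have lD := linearP D.
have bl := scale_l_bilin A (scalar_linear f); have ll := tlift_linear bl.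
have br := scale_r_bilin A (scalar_linear f); have lr := tlift_linear br.
rewrite -[LHS](tmap_comp _ (@lin_id _ _) lD (@lin_id _ _) ll) -comulA.
rewrite -[RHS](tmap_comp _ lD (@lin_id _ _) lr (@lin_id _ _)).
exact: (tassoc_scale_m (scalar_linear f)).
Qed.

Lemma conv_bilin (f g : {scalar A}) : bilin (fun x y : A => f x * g y : K^o).
Proof. exact: (bilin_comp (scale_bilin K^o) (scalar_linear f) (scalar_linear g)). Qed.

Lemma conv_linear (f g : {scalar A}) : linear (conv H f g : A -> K^o).
Proof. exact: (lin_comp (tlift_linear (conv_bilin f g)) (linearP D)). Qed.

Lemma scalar_lconv (f g : {scalar A}) a : f (lconv H g a) = conv H f g a.
Proof.
rewrite /lconv (lin_tlift _ (scalar_linear f) (scale_r_bilin _ (scalar_linear g))).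
apply: tlift_eq (bilin_post (scalar_linear f) _) (conv_bilin f g) _ => [|x y].
  exact: (scale_r_bilin _ (scalar_linear g)).
by rewrite scalarZ mulrC.
Qed.

Lemma scalar_rconv (f g : {scalar A}) a : f (rconv g a) = conv H g f a.
Proof.
rewrite /rconv (lin_tlift _ (scalar_linear f) (scale_l_bilin _ (scalar_linear g))).
apply: tlift_eq (bilin_post (scalar_linear f) _) (conv_bilin g f) _ => [|x y].
  exact: (scale_l_bilin _ (scalar_linear g)).
by rewrite scalarZ.
Qed.

Lemma lconv_comp (f g : {scalar A}) a :
  lconv H f (lconv H g a) = lconv H (conv H f g) a.
Proof.
have bf := scale_r_bilin A (scalar_linear f); have lg := lconv_linear g.
rewrite /(lconv H f) comul_lconv (tlift_tmap _ bf (@lin_id _ _) lg).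
apply: tlift_eq (bilin_comp bf (@lin_id _ _) lg) _ _ => [|x y].
  exact: scale_r_bilin _ (conv_linear f g).
by rewrite scalar_lconv.
Qed.

(** Under convolution, functionals act from the left through [lconv] and from the right through
    [rconv]; hence the reversed order here. *)
Lemma rconv_comp (f g : {scalar A}) a : rconv f (rconv g a) = rconv (conv H g f) a.
Proof.
have bf := scale_l_bilin A (scalar_linear f); have lg := rconv_linear g.
rewrite /(rconv f) comul_rconv (tlift_tmap _ bf lg (@lin_id _ _)).
apply: tlift_eq (bilin_comp bf lg (@lin_id _ _)) _ _ => [|x y].
  exact: scale_l_bilin _ (conv_linear g f).
by rewrite scalar_rconv.
Qed.

Lemma lconv_rconv (f g : {scalar A}) a : lconv H f (rconv g a) = rconv g (lconv H f a).
Proof.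
have bf := scale_r_bilin A (scalar_linear f); have lg := rconv_linear g.
rewrite /(lconv H f) comul_rconv (tlift_tmap _ bf lg (@lin_id _ _)).
rewrite (lin_tlift _ lg bf).
apply: tlift_eq (bilin_comp bf lg (@lin_id _ _)) (bilin_post lg bf) _ => x y.
by rewrite (linZ lg).
Qed.
End Convolution.

(** * The antipode *)

Section ConvolutionDivision.
Variables (K : fieldType) (A : algType K).
Implicit Types V : lmodType K.

Lemma tassoc_mul (h k : A -> A) (lh : linear h) (lk : linear k)
    (t : tensor (tensor A A) A) :
  tlift (fun x w => h x * w) (tmap id (tlift (fun y z => y * k z)) (tassoc t))
  = tlift (fun w z => w * k z) (tmap (tlift (fun x y => h x * y)) id t).
Proof.
have bm := mul_bilin A.
have bh := bilin_comp bm lh (@lin_id _ A); have bk := bilin_comp bm (@lin_id _ A) lk.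
have lth := tlift_linear bh; have ltk := tlift_linear bk.
have mk := tmap_linear (@lin_id _ A) ltk; have mh := tmap_linear lth (@lin_id _ A).
have l1 := lin_comp lth (lin_comp mk (@tassoc_linear _ A A A)).
have l2 := lin_comp ltk mh.
move: t; apply: (tens3_ext l1 l2) => x y z.
rewrite tassoc_tens (tmap_tens _ _ (@lin_id _ A) ltk) (tmap_tens _ _ lth (@lin_id _ A)).
transitivity (h x * (y * k z)).
  exact: (etrans (tlift_tens bh x _) (congr1 (fun w => h x * w) (tlift_tens bk y z))).
rewrite mulrA; apply: esym.
exact: (etrans (tlift_tens bk _ z) (congr1 (fun w => w * k z) (tlift_tens bh x y))).
Qed.

End ConvolutionDivision.

Section Antipode.
Variables (K : fieldType) (A : algType K) (H : hopf_structure A).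
Local Notation D := (comul H).
Local Notation eps := (counit H).
Local Notation kap := (antipode H).

(** In the convolution algebra of endomorphisms the antipode inverts the identity, so
    $h*\mathrm{id}=g$ gives $h=g*\kappa$. *)
Lemma conv_antipodeK (h g : A -> A) :
  linear h -> (forall a, tlift (fun x y => h x * y) (D a) = g a) ->
  forall a, h a = tlift (fun x y => g x * kap y) (D a).
Proof.
move=> lh hg a; have lD := linearP D; have lk := linearP kap.
have bm := mul_bilin A; have lt := @lin_id _ A.
have bh := bilin_comp bm lh lt; have bk := bilin_comp bm lt lk.
have lth := tlift_linear bh; have ltk := tlift_linear bk.
have lhD := lin_comp lth lD; have lkD := lin_comp ltk lD.
(* The two sides are $h(a_1)\,a_2\,\kappa(a_3)$ with its two bracketings. *)
have := tassoc_mul lh lk (tmap D id (D a)).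
rewrite comulA (tmap_comp _ lt lD lt ltk) (tmap_comp _ lD lt lth lt).
rewrite (tlift_tmap _ bh lt lkD) (tlift_tmap _ bk lhD lt) => e.
transitivity (tlift (fun x y => tlift (fun x' y' => h x' * y') (D x) * kap y) (D a)).
  rewrite -e -[in LHS](counitr H a) (lin_tlift _ lh (scale_r_bilin _ (scalar_linear eps))).
  apply: tlift_eq => [||x y].
  - exact: (bilin_post lh (scale_r_bilin _ (scalar_linear eps))).
  - exact: (bilin_comp bh lt lkD).
  - by rewrite antipoder mulr_algr (linZ lh).
apply: tlift_eq => [||x y]; last by rewrite hg.
  exact: (bilin_comp bk lhD lt).
have lg : linear g by apply: (lin_eq _ lhD) => x; rewrite -hg.
exact: (bilin_comp bk lg lt).
Qed.

(* [kap (a_1 b) a_2 = eps a *: kap b], and the factor [a_2] is divided out by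
   [conv_antipodeK]. *)
Lemma antipodeM a b : kap (a * b) = kap b * kap a.
Proof.
have lD := linearP D; have lk := linearP kap.
have bm := mul_bilin A; have lt := @lin_id _ A.
have bk := bilin_comp bm lk lt.
pose T (x : tensor A A) (u : A) := tlift (fun x' y' => kap (x' * u) * y') x.
have bT1 u : bilin (fun x' y' : A => kap (x' * u) * y').
  exact: (bilin_comp bk (bilin_l u bm) lt).
have bT : bilin T.
  split=> [u|x]; first exact: (tlift_linear (bT1 u)).
  apply: lin_tlift_fun => [u|x' y']; first exact: bT1.
  exact: (lin_comp (bilin_l y' bk) (bilin_r x' bm)).
have Tid x y : tlift (fun u v => T x u * v) y = tlift (fun u v => kap u * v) (tmul *%R *%R x y).
  have bTx z : bilin (fun u v => T z u * v) by exact: (bilin_comp bm (bilin_r z bT) lt).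
  move: x y; apply: tmul_ext => [||x1 y1 x2 y2].
  - split=> [y|x]; last exact: (tlift_linear (bTx x)).
    apply: lin_tlift_fun => [x|u v]; first exact: bTx.
    exact: (lin_comp (bilin_l v bm) (bilin_l u bT)).
  - exact: (bilin_post (tlift_linear bk) (tmul_bilin bm bm)).
  rewrite (tmul_tens bm bm) (tlift_tens (bTx _)) (tlift_tens bk) /T.
  by rewrite (tlift_tens (bT1 _)) mulrA.
(* This identity is itself a division: convolving [T (D d)] with the identity in the second argument
   gives, by [Tid], the left antipode axiom at the product, that is the product of the counits. *)
have Tb d c : T (D d) c = eps d *: kap c.
  have lTd := bilin_r (D d) bT.
  rewrite (conv_antipodeK lTd (g := fun c => (eps d * eps c)%:A)) => [|e]; last first.
    by rewrite Tid -comulM antipodel counitM.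
  rewrite -{2}(counitl H c) (lin_tlift _ lk (scale_l_bilin _ (scalar_linear eps))).
  have ld := bilin_r (eps d : K^o) (scale_bilin A).
  have be := bilin_post lk (scale_l_bilin A (scalar_linear eps)).
  have le : linear (fun b => (eps d * eps b)%:A : A).
    by move=> u x y; rewrite linearP mulrDr scalerDl mulrCA scalerA.
  rewrite (lin_tlift _ ld be).
  apply: tlift_eq (bilin_comp bm le lk) (bilin_post ld be) _ => x y.
  by rewrite mulr_algl (linZ lk) scalerA.
have lmb : linear (fun a => kap (a * b)) by exact: (lin_comp lk (bilin_l b bm)).
rewrite (conv_antipodeK lmb (g := fun a => eps a *: kap b)) => [|d]; last exact: Tb.
rewrite -{2}(counitl H a) (lin_tlift _ lk (scale_l_bilin _ (scalar_linear eps))).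
have be := bilin_post lk (scale_l_bilin A (scalar_linear eps)).
rewrite (lin_tlift _ (bilin_r (kap b) bm) be).
apply: tlift_eq => [||x y]; last by rewrite (linZ lk) -scalerAl -scalerAr.
  exact: (bilin_comp bm (bilin_l (kap b) (scale_l_bilin A (scalar_linear eps))) lk).
exact: (bilin_post (bilin_r (kap b) bm) be).
Qed.

Section Comatrix.
Variables (J : finType).

(** The matrix coefficients of a finite-dimensional corepresentation. *)
Definition comatrix (T : J -> J -> A) : Prop :=
  (forall i j, D (T i j) = \sum_k T i k \ox T k j) /\
  (forall i j, eps (T i j) = (i == j)%:R).

Variable T : J -> J -> A.
Hypothesis cT : comatrix T.

Lemma comatrix_antipodel i j : \sum_k kap (T i k) * T k j = (i == j)%:R.
Proof.
have bk := bilin_comp (mul_bilin A) (linearP kap) (@lin_id _ A).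
have := antipodel H (T i j); rewrite cT.1 cT.2 (lin_sum _ (tlift_linear bk)).
rewrite scaler_nat => <-; apply: eq_bigr => k _; exact/esym/(tlift_tens bk).
Qed.

Lemma comatrix_antipoder i j : \sum_k T i k * kap (T k j) = (i == j)%:R.
Proof.
have bk := bilin_comp (mul_bilin A) (@lin_id _ A) (linearP kap).
have := antipoder H (T i j); rewrite cT.1 cT.2 (lin_sum _ (tlift_linear bk)).
rewrite scaler_nat => <-; apply: eq_bigr => k _; exact/esym/(tlift_tens bk).
Qed.

(** Apply the counit to $\kappa(T)T=1$; the counit of $T$ is the identity matrix. *)
Lemma counit_comatrix_antipode i j : eps (kap (T i j)) = (i == j)%:R.
Proof.
have := congr1 eps (comatrix_antipodel i j); rewrite linear_sum (bigD1 j) //=.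
rewrite counitM cT.2 eqxx mulr1 big1 => [|k /negPf kj]; last first.
  by rewrite counitM cT.2 kj mulr0.
rewrite addr0 => ->; case: eqP => _; [exact: counit1|exact: linear0].
Qed.

Local Notation "x '\**' y" := (tmul *%R *%R x y) (at level 40, left associativity).

(** Over [tensor A A], the left-hand side is a left inverse of the matrix $\Delta(T)$ and the
    right-hand side a right inverse, so they agree. *)
Lemma comul_comatrix_antipode i j :
  D (kap (T i j)) = \sum_k kap (T k j) \ox kap (T i k).
Proof.
have bm := mul_bilin A; have bt := tmul_bilin bm bm.
have mA (x y z : tensor A A) : x \** y \** z = x \** (y \** z).
  by apply: (tmulA bm bm bm bm bm bm bm bm) => *; rewrite mulrA.
pose one : tensor A A := 1 \ox 1.
have m1 (x : tensor A A) : x \** one = x.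
  apply: (tens_ext (bilin_l _ bt) (@lin_id _ _)) => a b.
  by rewrite (tmul_tens bm bm) !mulr1.
have lm (x : tensor A A) : one \** x = x.
  apply: (tens_ext (bilin_r _ bt) (@lin_id _ _)) => a b.
  by rewrite (tmul_tens bm bm) !mul1r.
have YX a b : \sum_k D (kap (T a k)) \** D (T k b) = (a == b)%:R *: one.
  under eq_bigr do rewrite -comulM.
  rewrite -linear_sum comatrix_antipodel /one -(comul1 H) -linearZ; congr (D _).
  by rewrite scaler_nat.
pose Z a b := \sum_k kap (T k b) \ox kap (T a k).
have XZ a b : \sum_k D (T a k) \** Z k b = (a == b)%:R *: one.
  have bo := tens_bilin A A.
  (* Summing over [k] contracts the second legs and forces [c = d]; summing over [c] then contracts
     the first legs. *)
  transitivity (\sum_k \sum_c \sum_d (T a c * kap (T d b)) \ox (T c k * kap (T k d))).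
    apply: eq_bigr => k _; rewrite cT.1 (lin_sum _ (bilin_l _ bt)).
    apply: eq_bigr => c _; apply: etrans (lin_sum _ (bilin_r (T a c \ox T c k) bt)) _.
    by apply: eq_bigr => d _; exact (tmul_tens bm bm (T a c) (T c k) (kap (T d b)) (kap (T k d))).
  rewrite exchange_big /=.
  transitivity (\sum_c (T a c * kap (T c b)) \ox (1 : A)).
    have S (u : A) c d : \sum_k u \ox (T c k * kap (T k d)) = u \ox ((c == d)%:R : A).
      by rewrite -comatrix_antipoder -(lin_sum _ (bilin_r u bo)).
    apply: eq_bigr => c _; rewrite exchange_big /=; under eq_bigr do rewrite S.
    rewrite (bigD1 c) //= eqxx big1 ?addr0 // => d /negPf dc.
    by rewrite eq_sym dc (lin0 (bilin_r _ bo)).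
  rewrite -(lin_sum (fun c => T a c * kap (T c b)) (bilin_l 1 bo)) comatrix_antipoder.
  by rewrite -(linZ (bilin_l 1 bo)) scaler_nat.
exact: (bilin_inverse_unique bt mA m1 lm YX XZ i j).
Qed.

End Comatrix.
End Antipode.

(** * Bimodules over Hopf algebras, free as left modules *)

Section MatrixFunctionals.
Variables (K : fieldType) (A : algType K) (H : hopf_structure A) (I : finType).

(** A unital algebra homomorphism from [A] to matrices over [K], given by its entries. Both [lconv]
    and [rconv] lift it to homomorphisms from [A] to matrices over [A]. *)
Definition matrix_functional (f : I -> I -> {scalar A}) : Prop :=
  (forall i j, f i j 1 = (i == j)%:R) /\
  (forall i j a b, f i j (a * b) = \sum_k f i k a * f k j b).

Variable f : I -> I -> {scalar A}.
Hypothesis cf : matrix_functional f.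

Lemma lconv_matrix1 i j : lconv H (f i j) 1 = (i == j)%:R.
Proof.
rewrite /lconv comul1 (tlift_tens (scale_r_bilin _ (scalar_linear _))) cf.1.
exact: scaler_nat.
Qed.

Lemma lconv_matrixM i j a b :
  lconv H (f i j) (a * b) = \sum_k lconv H (f i k) a * lconv H (f k j) b.
Proof.
have bm := mul_bilin A; have bf k l := scale_r_bilin A (scalar_linear (f k l)).
have lf k l := tlift_linear (bf k l).
rewrite /lconv comulM; move: (comul H a) (comul H b).
apply: (tmul_ext (bilin_post (lf i j) (tmul_bilin bm bm))) => [|x1 y1 x2 y2].
  by apply: bilin_bigsum => k; exact: (bilin_comp bm (lf i k) (lf k j)).
rewrite (tmul_tens bm bm) (tlift_tens (bf i j)) cf.2 scaler_suml.
apply: eq_bigr => k _; rewrite (tlift_tens (bf i k)) (tlift_tens (bf k j)).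
by rewrite -scalerAl -scalerAr scalerA.
Qed.

Lemma rconv_matrix1 i j : rconv H (f i j) 1 = (i == j)%:R.
Proof.
rewrite /rconv comul1 (tlift_tens (scale_l_bilin _ (scalar_linear _))) cf.1.
exact: scaler_nat.
Qed.

Lemma rconv_matrixM i j a b :
  rconv H (f i j) (a * b) = \sum_k rconv H (f i k) a * rconv H (f k j) b.
Proof.
have bm := mul_bilin A; have bf k l := scale_l_bilin A (scalar_linear (f k l)).
have lf k l := tlift_linear (bf k l).
rewrite /rconv comulM; move: (comul H a) (comul H b).
apply: (tmul_ext (bilin_post (lf i j) (tmul_bilin bm bm))) => [|x1 y1 x2 y2].
  by apply: bilin_bigsum => k; exact: (bilin_comp bm (lf i k) (lf k j)).
rewrite (tmul_tens bm bm) (tlift_tens (bf i j)) cf.2 scaler_suml.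
apply: eq_bigr => k _; rewrite (tlift_tens (bf i k)) (tlift_tens (bf k j)).
by rewrite -scalerAl -scalerAr scalerA.
Qed.

End MatrixFunctionals.

Section FreeModule.
Variables (K : fieldType) (A : algType K) (H : hopf_structure A) (I : finType).
Variables (G : lmodType K) (lact : A -> G -> G) (om : I -> G) (co : I -> G -> A).

(** Freeness is expressed through coordinate maps [co]. The bimodule is constructed from these laws
    alone; the concrete module of functions enters only at the end. *)
Record free_module : Prop := FreeModule {
  free_bilin : bilin lact;
  free_act1 : forall g, lact 1 g = g;
  free_actM : forall a b g, lact (a * b) g = lact a (lact b g);
  free_co_linear : forall i, linear (co i);
  free_co_act : forall i a g, co i (lact a g) = a * co i g;
  free_co_basis : forall i j, co i (om j) = (j == i)%:R;
  free_sum : forall g, g = \sum_i lact (co i g) (om i) }.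

Hypothesis fG : free_module.
Let bl := free_bilin fG.
Let lc := free_co_linear fG.

Section Coaction.
Variables (P : lmodType K) (act : tensor A A -> P -> P) (m : I -> P).
Hypothesis bact : bilin act.
Hypothesis act1 : forall p, act (1 \ox 1) p = p.
Hypothesis actM : forall x y p, act (tmul *%R *%R x y) p = act x (act y p).

(** The extension of [om i |-> m i] that is equivariant along the coproduct. The target is any space
    with an action of [tensor A A], so that $\Delta_L$ and $\Delta_R$ are two instances of one
    construction. *)
Definition coact (g : G) : P := \sum_i act (comul H (co i g)) (m i).

Lemma coact_linear : linear coact.
Proof.
apply: lin_bigsum => i.
exact: (lin_comp (bilin_l (m i) bact) (lin_comp (linearP (comul H)) (lc i))).
Qed.

Lemma coact_act a g : coact (lact a g) = act (comul H a) (coact g).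
Proof.
rewrite (lin_sum _ (bilin_r _ bact)); apply: eq_bigr => i _.
by rewrite (free_co_act fG) comulM actM.
Qed.

Lemma coact_basis i : coact (om i) = m i.
Proof.
rewrite /coact (bigD1 i) //= big1 => [|j ji].
  by rewrite addr0 (free_co_basis fG) eqxx comul1.
rewrite (free_co_basis fG) eq_sym (negPf ji) linear0.
exact: (lin0 (bilin_l _ bact)).
Qed.

End Coaction.

(** The tool for nearly every axiom of the bimodule: each is an equality of two maps equivariant
    along the same [th], which is the identity, the coproduct or the iterated coproduct, and it
    remains to compare them on the basis. *)
Lemma free_ext (P Q : lmodType K) (act : Q -> P -> P) (th : A -> Q) (C C' : G -> P) :
  linear C -> linear C' ->
  (forall a g, C (lact a g) = act (th a) (C g)) ->
  (forall a g, C' (lact a g) = act (th a) (C' g)) ->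
  (forall i, C (om i) = C' (om i)) -> C =1 C'.
Proof.
move=> lC lC' CM C'M e g; rewrite (free_sum fG g) (lin_sum _ lC) (lin_sum _ lC').
by apply: eq_bigr => i _; rewrite CM C'M e.
Qed.

Variable f : I -> I -> {scalar A}.
Hypothesis cf : matrix_functional f.

Definition fract (g : G) (a : A) : G :=
  \sum_i lact (co i g) (\sum_j lact (lconv H (f i j) a) (om j)).

Lemma fract_bilin : bilin fract.
Proof.
apply: bilin_bigsum => i; apply: (bilin_comp bl (lc i)).
apply: lin_bigsum => j; exact: (lin_comp (bilin_l _ bl) (lconv_linear H (f i j))).
Qed.

Lemma fract_basis i a : fract (om i) a = \sum_j lact (lconv H (f i j) a) (om j).
Proof.
rewrite /fract (bigD1 i) //= [X in _ + X]big1 => [|j ji].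
  by rewrite (free_co_basis fG) eqxx (free_act1 fG) addr0.
by rewrite (free_co_basis fG) eq_sym (negPf ji) (lin0 (bilin_l _ bl)).
Qed.

Lemma fract_act a g b : fract (lact a g) b = lact a (fract g b).
Proof.
rewrite (lin_sum _ (bilin_r _ bl)); apply: eq_bigr => i _.
by rewrite (free_co_act fG) (free_actM fG).
Qed.

Lemma fract1 g : fract g 1 = g.
Proof.
apply: (free_ext (act := lact) (th := id) (bilin_l 1 fract_bilin) (@lin_id _ G)) => //.
  by move=> a h; exact: fract_act.
move=> i; rewrite fract_basis (bigD1 i) //= big1 => [|j ji].
  by rewrite (lconv_matrix1 _ cf) eqxx (free_act1 fG) addr0.
by rewrite (lconv_matrix1 _ cf) eq_sym (negPf ji) (lin0 (bilin_l _ bl)).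
Qed.

Lemma fractM g a b : fract g (a * b) = fract (fract g a) b.
Proof.
have lab := bilin_l (a * b) fract_bilin.
have la_b := lin_comp (bilin_l b fract_bilin) (bilin_l a fract_bilin).
move: g; apply: (free_ext (act := lact) (th := id) lab la_b) => [c g|c g|i].
- exact: fract_act.
- by rewrite !fract_act.
rewrite !fract_basis (lin_sum _ (bilin_l b fract_bilin)).
under [RHS]eq_bigr => k _.
  rewrite fract_act fract_basis (lin_sum _ (bilin_r _ bl)).
  over.
rewrite exchange_big; apply: eq_bigr => j _ /=.
rewrite (lconv_matrixM _ cf) (lin_sum _ (bilin_l (om j) bl)).
by apply: eq_bigr => k _; rewrite (free_actM fG).
Qed.

End FreeModule.

(** * Bicovariance from the three conditions of Woronowicz *)

Section FreeBicovariantBimodule.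
Variables (K : fieldType) (A : algType K) (H : hopf_structure A) (I : finType).
Variables (G : lmodType K) (lact : A -> G -> G) (om : I -> G) (co : I -> G -> A).
Hypothesis fG : free_module lact om co.
Variable f : I -> I -> {scalar A}.
Hypothesis cf : matrix_functional f.
Variable M : I -> I -> A.
Hypothesis cM : comatrix H M.
Hypothesis fM : forall i l a,
  \sum_j lconv H (f i j) a * M l j = \sum_k M k i * rconv H (f k l) a.

Local Notation D := (comul H).
Local Notation ract := (fract H lact om co f).
Let bl := free_bilin fG.
Let bm := mul_bilin A.
Let br : bilin ract := fract_bilin H fG f.
Let lD : linear D := linearP D.
Let lG := @lin_id _ G.
Let lA := @lin_id _ A.
Let mA (a b c : A) : a * b * c = a * (b * c) := esym (mulrA a b c).

Let actL_bilin : bilin (tmul *%R lact) := tmul_bilin bm bl.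
Let actR_bilin : bilin (tmul lact *%R) := tmul_bilin bl bm.

Lemma actL1 (t : tensor A G) : tmul *%R lact (1 \ox 1) t = t.
Proof.
apply: (tens_ext (bilin_r _ actL_bilin) (@lin_id _ _)) => a g.
by rewrite (tmul_tens bm bl) mul1r (free_act1 fG).
Qed.

Lemma actR1 (t : tensor G A) : tmul lact *%R (1 \ox 1) t = t.
Proof.
apply: (tens_ext (bilin_r _ actR_bilin) (@lin_id _ _)) => g a.
by rewrite (tmul_tens bl bm) mul1r (free_act1 fG).
Qed.

Lemma actLM (x y : tensor A A) (t : tensor A G) :
  tmul *%R lact (tmul *%R *%R x y) t = tmul *%R lact x (tmul *%R lact y t).
Proof. exact: (tmulA bm bm bm bm bm bl bl bl mA (free_actM fG)). Qed.

Lemma actRM (x y : tensor A A) (t : tensor G A) :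
  tmul lact *%R (tmul *%R *%R x y) t = tmul lact *%R x (tmul lact *%R y t).
Proof. exact: (tmulA bm bl bl bl bm bm bm bm (free_actM fG) mA). Qed.

Definition free_coactL : G -> tensor A G :=
  coact H co (tmul *%R lact) (fun i => 1 \ox om i).
Definition free_coactR : G -> tensor G A :=
  coact H co (tmul lact *%R) (fun i => \sum_j om j \ox M j i).

Let cL_linear : linear free_coactL := coact_linear H fG _ actL_bilin.
Let cR_linear : linear free_coactR := coact_linear H fG _ actR_bilin.

Lemma free_coactL_act a g : free_coactL (lact a g) = tmul *%R lact (D a) (free_coactL g).
Proof. exact: (coact_act H fG _ actL_bilin actLM). Qed.
Lemma free_coactR_act a g : free_coactR (lact a g) = tmul lact *%R (D a) (free_coactR g).
Proof. exact: (coact_act H fG _ actR_bilin actRM). Qed.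

Lemma free_coactL_basis i : free_coactL (om i) = 1 \ox om i.
Proof. exact: (coact_basis H fG _ actL_bilin actL1). Qed.
Lemma free_coactR_basis i : free_coactR (om i) = \sum_j om j \ox M j i.
Proof. exact: (coact_basis H fG _ actR_bilin actR1). Qed.

Let bmm := tmul_bilin bm bm.
(** The iterated coproduct. In each of the two coassociativity laws and in the commutation of the
    coactions, one side is equivariant along it directly and the other by coassociativity. *)
Let th a : tensor A (tensor A A) := tmap id D (D a).

Lemma free_coactLA g :
  tassoc (tmap D id (free_coactL g)) = tmap id free_coactL (free_coactL g).
Proof.
have lDid := tmap_linear lD lG; have lid := tmap_linear lA cL_linear.
have l1 := lin_comp (@tassoc_linear _ A A G) (lin_comp lDid cL_linear).
have l2 := lin_comp lid cL_linear.
move: g; apply: (free_ext fG (act := tmul *%R (tmul *%R lact)) (th := th) l1 l2).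
- move=> a g; rewrite free_coactL_act.
  rewrite (tmap_tmul bm bl bmm bl lD lD lD lA lG lG (comulM H) (fun _ _ => erefl)).
  by rewrite (tassoc_tmul bm bm bl) comulA.
- move=> a g; rewrite free_coactL_act.
  exact: (tmap_tmul bm bl bm actL_bilin lA lA lA lD cL_linear cL_linear
            (fun _ _ => erefl) free_coactL_act).
move=> i; rewrite free_coactL_basis (tmap_tens _ _ lD lG) (tmap_tens _ _ lA cL_linear).
by rewrite comul1 free_coactL_basis tassoc_tens.
Qed.

Lemma free_coactRA g :
  tassoc (tmap free_coactR id (free_coactR g)) = tmap id D (free_coactR g).
Proof.
have lRid := tmap_linear cR_linear lA; have lid := tmap_linear lG lD.
have l1 := lin_comp (@tassoc_linear _ G A A) (lin_comp lRid cR_linear).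
have l2 := lin_comp lid cR_linear.
move: g; apply: (free_ext fG (act := tmul lact (tmul *%R *%R)) (th := th) l1 l2).
- move=> a g; rewrite free_coactR_act.
  rewrite (tmap_tmul bl bm actR_bilin bm lD cR_linear cR_linear lA lA lA free_coactR_act
            (fun _ _ => erefl)).
  by rewrite (tassoc_tmul bl bm bm) comulA.
- move=> a g; rewrite free_coactR_act.
  exact: (tmap_tmul bl bm bl bmm lA lG lG lD lD lD (fun _ _ => erefl) (comulM H)).
move=> i; rewrite free_coactR_basis (lin_sum _ lid).
rewrite (lin_sum _ (lin_comp (@tassoc_linear _ G A A) lRid)).
transitivity (\sum_j \sum_l om l \ox (M l j \ox M j i)).
  apply: eq_bigr => j _; rewrite (tmap_tens _ _ cR_linear lA) free_coactR_basis.
  rewrite (lin_sum _ (bilin_l (M j i) (tens_bilin _ _))).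
  rewrite (lin_sum _ (@tassoc_linear _ G A A)).
  by apply: eq_bigr => l _; exact: tassoc_tens.
rewrite exchange_big; apply: eq_bigr => l _ /=.
rewrite (tmap_tens _ _ lG lD) cM.1.
exact: (esym (lin_sum _ (bilin_r (om l) (tens_bilin _ _)))).
Qed.

Lemma free_coactLR g :
  tmap id free_coactR (free_coactL g) = tassoc (tmap free_coactL id (free_coactR g)).
Proof.
have lidR := tmap_linear lA cR_linear; have lLid := tmap_linear cL_linear lA.
have l1 := lin_comp lidR cL_linear.
have l2 := lin_comp (@tassoc_linear _ A G A) (lin_comp lLid cR_linear).
move: g; apply: (free_ext fG (act := tmul *%R (tmul lact *%R)) (th := th) l1 l2).
- move=> a g; rewrite free_coactL_act.
  exact: (tmap_tmul bm bl bm actR_bilin lA lA lA lD cR_linear cR_linear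
            (fun _ _ => erefl) free_coactR_act).
- move=> a g; rewrite free_coactR_act.
  rewrite (tmap_tmul bl bm actL_bilin bm lD cL_linear cL_linear lA lA lA free_coactL_act
            (fun _ _ => erefl)).
  by rewrite (tassoc_tmul bm bl bm) comulA.
move=> i; rewrite free_coactL_basis (tmap_tens _ _ lA cR_linear) free_coactR_basis.
rewrite (lin_sum _ (bilin_r 1 (tens_bilin _ _))).
rewrite (lin_sum _ (lin_comp (@tassoc_linear _ A G A) lLid)).
apply: eq_bigr => j _; rewrite (tmap_tens _ _ cL_linear lA) free_coactL_basis.
exact: (esym (tassoc_tens _ _ _)).
Qed.

Lemma free_coactL_counit g : tlift (fun a x => counit H a *: x) (free_coactL g) = g.
Proof.
have be U := scale_l_bilin U (scalar_linear (counit H)).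
have leG := tlift_linear (be G).
have l1 := lin_comp leG cL_linear.
move: g; apply: (free_ext fG (act := lact) (th := id) l1 lG) => [a g|a g|i] //.
  rewrite free_coactL_act (tlift_tmul bm bl bl (be A) (be G) (be G)) ?counitl //.
  by move=> v w v' w'; rewrite counitM (linZ (bilin_l _ bl)) (linZ (bilin_r _ bl)) scalerA.
by rewrite free_coactL_basis (tlift_tens (be G)) counit1 scale1r.
Qed.

Lemma free_coactR_counit g : tlift (fun x a => counit H a *: x) (free_coactR g) = g.
Proof.
have be U := scale_r_bilin U (scalar_linear (counit H)).
have leG := tlift_linear (be G).
have l1 := lin_comp leG cR_linear.
move: g; apply: (free_ext fG (act := lact) (th := id) l1 lG) => [a g|a g|i] //.
  rewrite free_coactR_act (tlift_tmul bl bm bl (be A) (be G) (be G)) ?counitr //.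
  by move=> v w v' w'; rewrite counitM (linZ (bilin_l _ bl)) (linZ (bilin_r _ bl)) scalerA.
rewrite free_coactR_basis (lin_sum _ leG) (bigD1 i) //= big1 => [|j ji].
  by rewrite (tlift_tens (be G)) cM.2 eqxx scale1r addr0.
by rewrite (tlift_tens (be G)) cM.2 (negPf ji) scale0r.
Qed.

Let bo (V W : lmodType K) := tens_bilin V W.
Let llc i j := lconv_linear H (f i j).
Let lrc i j := rconv_linear H (f i j).
Let lom l : linear (lact^~ (om l)) := bilin_l (om l) bl.
Let lM k i : linear (fun y => M k i * y) := bilin_r (M k i) bm.
Let bLr : bilin (tmul *%R ract) := tmul_bilin bm br.
Let bRr : bilin (tmul ract *%R) := tmul_bilin br bm.

(** Left covariance is [comul_lconv]: the convolution $f*b$ touches only the second leg of the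
    coproduct of $b$, and $\omega^i$ is left invariant. *)
Lemma free_coactL_basis_ract i b :
  free_coactL (ract (om i) b) = tmul *%R ract (1 \ox om i) (D b).
Proof.
rewrite (fract_basis H fG) (lin_sum _ cL_linear).
transitivity (\sum_j tmul *%R lact (tmap id (lconv H (f i j)) (D b)) (1 \ox om j)).
  by apply: eq_bigr => j _; rewrite free_coactL_act comul_lconv free_coactL_basis.
have l1 : linear (fun t : tensor A A =>
    \sum_j tmul *%R lact (tmap id (lconv H (f i j)) t) (1 \ox om j)).
  apply: lin_bigsum => j.
  exact: (lin_comp (bilin_l (1 \ox om j) actL_bilin) (tmap_linear lA (llc i j))).
move: (D b); apply: (tens_ext l1 (bilin_r (1 \ox om i) bLr)) => x y.
rewrite (tmul_tens bm br) mul1r (fract_basis H fG).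
rewrite (lin_sum _ (bilin_r x (bo A G))).
apply: eq_bigr => j _; rewrite (tmap_tens _ _ lA (llc i j)).
by rewrite (tmul_tens bm bl) mulr1.
Qed.

(** The place where [fM] enters: $b_1\omega^l\otimes(f^i{}_j*b_2)M_l{}^j = b_1\omega^l\otimes
    M_k{}^i(b_2*f^k{}_l) = (f^k{}_l*b_1)\omega^l\otimes M_k{}^i b_2$, the second equality being
    [tmap_rconv]; the last expression is $\omega^k b_1\otimes M_k{}^i b_2$. *)
Lemma free_coactR_basis_ract i b :
  free_coactR (ract (om i) b) = tmul ract *%R (\sum_k om k \ox M k i) (D b).
Proof.
rewrite (fract_basis H fG) (lin_sum _ cR_linear).
transitivity (\sum_j tmul lact *%R (tmap id (lconv H (f i j)) (D b))
                       (\sum_l om l \ox M l j)).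
  by apply: eq_bigr => j _; rewrite free_coactR_act comul_lconv free_coactR_basis.
pose X k l := tmap (lact^~ (om l)) (fun y => M k i * y).
have lX k l : linear (X k l) := tmap_linear (lom l) (lM k i).
transitivity (\sum_k \sum_l X k l (tmap id (rconv H (f k l)) (D b))).
  have l1 : linear (fun t : tensor A A => \sum_j tmul lact *%R (tmap id (lconv H (f i j)) t)
                       (\sum_l om l \ox M l j)).
    apply: lin_bigsum => j.
    exact: (lin_comp (bilin_l (\sum_l om l \ox M l j) actR_bilin)
                     (tmap_linear lA (llc i j))).
  have l2 : linear (fun t : tensor A A => \sum_k \sum_l X k l (tmap id (rconv H (f k l)) t)).
    apply: lin_bigsum => k; apply: lin_bigsum => l.
    exact: (lin_comp (lX k l) (tmap_linear lA (lrc k l))).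
  move: (D b); apply: (tens_ext l1 l2) => x y; rewrite [RHS]exchange_big /=.
  transitivity (\sum_j \sum_l lact x (om l) \ox (lconv H (f i j) y * M l j)).
    apply: eq_bigr => j _; rewrite (tmap_tens _ _ lA (llc i j)).
    apply: (etrans (lin_sum _ (bilin_r (x \ox lconv H (f i j) y) actR_bilin))).
    by apply: eq_bigr => l _; exact (tmul_tens bl bm x (lconv H (f i j) y) (om l) (M l j)).
  rewrite exchange_big; apply: eq_bigr => l _ /=.
  apply: (etrans (esym (lin_sum _ (bilin_r (lact x (om l)) (bo G A))))).
  rewrite fM; apply: (etrans (lin_sum _ (bilin_r (lact x (om l)) (bo G A)))).
  apply: eq_bigr => k _; rewrite (tmap_tens _ _ lA (lrc k l)).
  exact: (esym (tmap_tens _ _ (lom l) (lM k i))).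
under eq_bigr do under eq_bigr do rewrite tmap_rconv.
have l1 : linear (fun t : tensor A A => \sum_k \sum_l X k l (tmap (lconv H (f k l)) id t)).
  apply: lin_bigsum => k; apply: lin_bigsum => l.
  exact: (lin_comp (lX k l) (tmap_linear (llc k l) lA)).
move: (D b); apply: (tens_ext l1 (bilin_r _ bRr)) => x y /=.
rewrite (lin_sum _ (bilin_l (x \ox y) bRr)); apply: eq_bigr => k _.
rewrite (tmul_tens br bm) (fract_basis H fG).
apply: esym; apply: (etrans (lin_sum _ (bilin_l (M k i * y) (bo G A)))).
apply: eq_bigr => l _; rewrite (tmap_tens _ _ (llc k l) lA).
exact: (esym (tmap_tens _ _ (lom l) (lM k i))).
Qed.

Lemma free_coactL_ract g b :
  free_coactL (ract g b) = tmul *%R ract (free_coactL g) (D b).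
Proof.
have l1 := lin_comp cL_linear (bilin_l b br).
have l2 := lin_comp (bilin_l (D b) bLr) cL_linear.
move: g; apply: (free_ext fG (act := tmul *%R lact) (th := D) l1 l2) => [a g|a g|i].
- by rewrite (fract_act H fG) free_coactL_act.
- by rewrite free_coactL_act (tmulA bm bm bm bm bl br br bl mA (fract_act H fG f)).
- by rewrite free_coactL_basis_ract free_coactL_basis.
Qed.

Lemma free_coactR_ract g b :
  free_coactR (ract g b) = tmul ract *%R (free_coactR g) (D b).
Proof.
have l1 := lin_comp cR_linear (bilin_l b br).
have l2 := lin_comp (bilin_l (D b) bRr) cR_linear.
move: g; apply: (free_ext fG (act := tmul lact *%R) (th := D) l1 l2) => [a g|a g|i].
- by rewrite (fract_act H fG) free_coactR_act.
- by rewrite free_coactR_act (tmulA bl br br bl bm bm bm bm (fract_act H fG f) mA).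
- by rewrite free_coactR_basis_ract free_coactR_basis.
Qed.

Let cL : {linear G -> tensor A G} :=
  HB.pack free_coactL (GRing.isLinear.Build K G (tensor A G) *:%R free_coactL cL_linear).
Let cR : {linear G -> tensor G A} :=
  HB.pack free_coactR (GRing.isLinear.Build K G (tensor G A) *:%R free_coactR cR_linear).

Let cL_cov a g b : cL (ract (lact a g) b)
  = tmul *%R ract (tmul *%R lact (D a) (cL g)) (D b).
Proof. by rewrite -free_coactL_act; exact: free_coactL_ract. Qed.
Let cR_cov a g b : cR (ract (lact a g) b)
  = tmul ract *%R (tmul lact *%R (D a) (cR g)) (D b).
Proof. by rewrite -free_coactR_act; exact: free_coactR_ract. Qed.

Definition free_bicovariant_bimodule : bicovariant_bimodule H G :=
  @BicovariantBimodule K A H G lact ract cL cR bl br (free_act1 fG)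
    (free_actM fG) (fract1 H fG cf) (fractM H fG cf) (fract_act H fG f)
    free_coactLA free_coactL_counit free_coactRA free_coactR_counit
    cL_cov cR_cov free_coactLR.

End FreeBicovariantBimodule.

(** * Presentation of GL *)

Section QuantumGroupInduction.
Variable K : fieldType.

Lemma freealg_ind (X : choiceType) (P : freealg K X -> Prop) :
  P 1 -> (forall x, P (freegen K x)) ->
  (forall c a, P a -> P (c *: a)) ->
  (forall a b, P a -> P b -> P (a + b)) -> (forall a b, P a -> P b -> P (a * b)) ->
  forall a, P a.
Proof.
move=> P1 Px PZ PD PM a; rewrite (monalgE a).
have P0 : P 0 by rewrite -(scale0r 1); exact: PZ.
apply: (big_ind P) => // m _; rewrite malgUZ; apply: (PZ).
(* A monomial is a word; its letters are split off one at a time as generators. *)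
case: m => s; elim: s => [|x s IH]; first by rewrite -fmoneE.
rewrite (_ : << FMonom (x :: s) >> = freegen K x * << FMonom s >>); first exact: PM.
rewrite /freegen; apply: esym; rewrite malgM_def fgmulUU mulr1; congr << _ >>.
by apply/eqP; rewrite fmP fmM fmU.
Qed.

Variables (N : nat) (r : K) (q : 'I_N.+1 -> 'I_N.+1 -> K).
Local Notation GL := (GL r q).
Local Notation T := (GL_T r q).

Lemma GL_RTT_rel A B C D :
  \sum_E \sum_F Rmat r q A B E F *: (T E C * T F D)
  = \sum_E \sum_F Rmat r q E F C D *: (T B F * T A E).
Proof.
have P (c : 'I_N.+1 -> 'I_N.+1 -> K) u v :
    aproj (GLideal r q) (\sum_E \sum_F c E F *: (u E F * v E F))
    = \sum_E \sum_F c E F *: (aproj (GLideal r q) (u E F) * aproj (GLideal r q) (v E F)).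
  rewrite linear_sum; apply: eq_bigr => E _; rewrite linear_sum.
  by apply: eq_bigr => F _; rewrite linearZ rmorphM.
have e : aproj (GLideal r q) (\sum_E \sum_F Rmat r q A B E F *: (Tfree K E C * Tfree K F D))
  = aproj (GLideal r q) (\sum_E \sum_F Rmat r q E F C D *: (Tfree K B F * Tfree K A E)).
  by apply/(lprojP (GLideal r q)); exact/ideal_gen/GL_RTT.
exact: (etrans (esym (P _ (fun E _ => Tfree K E C) (fun _ F => Tfree K F D)))
         (etrans e (P _ (fun _ F => Tfree K B F) (fun E _ => Tfree K A E)))).
Qed.

(** The generator [GL_Xi] is replaced by closure under two-sided inverses, applied to the quantum
    determinant, which is a polynomial in the entries of $T$. This suits $L^\pm$, whose values are
    prescribed on those entries only. *)
Lemma GL_ind (P : GL -> Prop) :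
  P 1 -> (forall A B, P (T A B)) ->
  (forall c a, P a -> P (c *: a)) ->
  (forall a b, P a -> P b -> P (a + b)) -> (forall a b, P a -> P b -> P (a * b)) ->
  (forall a b, a * b = 1 -> b * a = 1 -> P a -> P b) ->
  forall a, P a.
Proof.
move=> P1 PT PZ PD PM PV x; rewrite -[x]aproj_surj; move: (lrepr x) => {x}.
have P0 : P 0 by rewrite -(scale0r 1); exact: PZ.
apply: freealg_ind => [|[[A B]|]|c a Pa|a b Pa Pb|a b Pa Pb].
- by rewrite rmorph1.
- exact: PT.
- apply: (PV (aproj (GLideal r q) (qdet r q (@Tfree K N)))).
  + rewrite -(rmorph1 (aproj (GLideal r q))) -rmorphM; apply/(lprojP (GLideal r q)).
    exact/ideal_gen/GL_detl.
  + rewrite -(rmorph1 (aproj (GLideal r q))) -rmorphM; apply/(lprojP (GLideal r q)).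
    exact/ideal_gen/GL_detr.
  + rewrite /qdet linear_sum; apply: (big_ind P) => // s _; rewrite linearZ; apply: (PZ).
    rewrite rmorph_prod; apply: (big_ind P) => // k _; exact: PT.
- by rewrite linearZ; exact: PZ.
- by rewrite raddfD; exact: PD.
- by rewrite rmorphM; exact: PM.
Qed.

End QuantumGroupInduction.

(** * Intertwining relations *)

Lemma tlift_bigsum (K : fieldType) (V W U : lmodType K) (J : finType)
    (b : J -> V -> W -> U) t :
  (forall j, bilin (b j)) ->
  \sum_j tlift (b j) t = tlift (fun v w => \sum_j b j v w) t.
Proof.
move=> bb; have bs := bilin_bigsum bb.
move: t; apply: (tens_ext _ (tlift_linear bs)) => [|v w].
  by apply: lin_bigsum => j; exact: tlift_linear.
by rewrite (tlift_tens bs); apply: eq_bigr => j _; exact: tlift_tens.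
Qed.

Lemma tlift_zero (K : fieldType) (V W U : lmodType K) (b : V -> W -> U) t :
  bilin b -> (forall v w, b v w = 0) -> tlift b t = 0.
Proof.
move=> bb b0; have l0 : linear (fun _ : tensor V W => 0 : U).
  by move=> c x y /=; rewrite scaler0 addr0.
by apply: (tens_ext (tlift_linear bb) l0) => v w; rewrite (tlift_tens bb).
Qed.

Section AntipodeFunctionals.
Variables (K : fieldType) (A : algType K) (H : hopf_structure A).
Local Notation D := (comul H).
Local Notation eps := (counit H).
Local Notation kap := (antipode H).

Lemma antipode1 : kap 1 = 1.
Proof.
have bk := bilin_comp (mul_bilin A) (linearP kap) (@lin_id _ A).
by have := antipodel H 1; rewrite comul1 (tlift_tens bk) counit1 scale1r mulr1.
Qed.

Definition conv_scalar (phi psi : {scalar A}) : {scalar A} :=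
  HB.pack (conv H phi psi)
    (GRing.isLinear.Build K A K *%R (conv H phi psi) (conv_linear H phi psi)).

Lemma conv_scalar1 (phi psi : {scalar A}) : conv_scalar phi psi 1 = phi 1 * psi 1.
Proof. by rewrite /= /conv comul1 (tlift_tens (conv_bilin phi psi)). Qed.

Lemma conv_zero_r (f g : {scalar A}) a : (forall x, g x = 0) -> conv H f g a = 0.
Proof.
move=> g0; apply: (tlift_zero _ (conv_bilin f g)) => x y.
by rewrite g0 mulr0.
Qed.

Lemma rconv_zero (f : {scalar A}) a : (forall x, f x = 0) -> rconv H f a = 0.
Proof.
move=> f0; apply: (tlift_zero _ (scale_l_bilin A (scalar_linear f))) => x y.
by rewrite f0 scale0r.
Qed.

Definition antipode_scalar (phi : {scalar A}) : {scalar A} := phi \o kap.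

Variable I : finType.

(** The counit is the unit of convolution, so it acts as the identity. Together with its mirror
    image this cancels $L^+$ against $\kappa' L^+$ when they act on an element. *)
Lemma sum_lconv_counit (g : I -> {scalar A}) (h : I -> {scalar A}) (c : K) a :
  (forall y, \sum_i conv H (g i) (h i) y = c * eps y) ->
  \sum_i lconv H (g i) (lconv H (h i) a) = c *: a.
Proof.
move=> gh; under eq_bigr do rewrite lconv_comp.
have be := scale_r_bilin A (scalar_linear eps).
have b i := scale_r_bilin A (conv_linear H (g i) (h i)).
rewrite (tlift_bigsum _ b) -{2}(counitr H a).
rewrite (lin_tlift _ (bilin_r (c : K^o) (scale_bilin A)) be).
apply: (tlift_eq _ (bilin_bigsum b)) => [|x y].
  exact: (bilin_post (bilin_r (c : K^o) (scale_bilin A)) be).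
by rewrite -scaler_suml gh scalerA.
Qed.

Lemma sum_rconv_counit (g : I -> {scalar A}) (h : I -> {scalar A}) (c : K) a :
  (forall y, \sum_i conv H (h i) (g i) y = c * eps y) ->
  \sum_i rconv H (g i) (rconv H (h i) a) = c *: a.
Proof.
move=> gh; under eq_bigr do rewrite rconv_comp.
have be := scale_l_bilin A (scalar_linear eps).
have b i := scale_l_bilin A (conv_linear H (h i) (g i)).
rewrite (tlift_bigsum _ b) -{2}(counitl H a).
rewrite (lin_tlift _ (bilin_r (c : K^o) (scale_bilin A)) be).
apply: (tlift_eq _ (bilin_bigsum b)) => [|x y].
  exact: (bilin_post (bilin_r (c : K^o) (scale_bilin A)) be).
by rewrite -scaler_suml gh scalerA.
Qed.

Variable L : I -> I -> {scalar A}.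
Hypothesis cL : matrix_functional L.
Local Notation lam i j := (antipode_scalar (L i j)).

(** By multiplicativity $L(a_1)L(\kappa(a_2))=L(a_1\kappa(a_2))=\varepsilon(a)L(1)$ as matrices: the
    matrix of the [lam] is the convolution inverse of [L]. *)
Lemma conv_antipode_r i j a :
  \sum_k conv H (L i k) (lam k j) a = (i == j)%:R * eps a.
Proof.
have b k := conv_bilin (L i k) (lam k j).
have bk := bilin_comp (mul_bilin A) (@lin_id _ A) (linearP kap).
rewrite (tlift_bigsum _ b) mulrC -cL.1 -scalarZ -antipoder.
rewrite (lin_tlift _ (scalar_linear (L i j)) bk).
apply: (tlift_eq _ (bilin_bigsum b)) => [|x y]; last by rewrite cL.2.
exact: (bilin_post (scalar_linear (L i j)) bk).
Qed.

Lemma conv_antipode_l i j a :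
  \sum_k conv H (lam i k) (L k j) a = (i == j)%:R * eps a.
Proof.
have b k := conv_bilin (lam i k) (L k j).
have bk := bilin_comp (mul_bilin A) (linearP kap) (@lin_id _ A).
rewrite (tlift_bigsum _ b) mulrC -cL.1 -scalarZ -antipodel.
rewrite (lin_tlift _ (scalar_linear (L i j)) bk).
apply: (tlift_eq _ (bilin_bigsum b)) => [|x y]; last by rewrite cL.2.
exact: (bilin_post (scalar_linear (L i j)) bk).
Qed.

Lemma antipode_scalar1 i j : lam i j 1 = (i == j)%:R.
Proof. by rewrite /= antipode1 cL.1. Qed.

End AntipodeFunctionals.

Section Intertwining.
Variables (K : fieldType) (A : algType K) (H : hopf_structure A) (I : finType).
Variable T : I -> I -> A.
Variable L : I -> I -> {scalar A}.
Hypothesis cL : matrix_functional L.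

(** The matrix identity $T\,(L*a)=(a*L)\,T$ over [A]. Both $L*a$ and $a*L$ are multiplicative in
    $a$, so $T$ can be moved past a product one factor at a time. *)
Definition intertwines (a : A) : Prop := forall i j,
  \sum_k T i k * lconv H (L k j) a = \sum_k rconv H (L i k) a * T k j.

Lemma intertwines1 : intertwines 1.
Proof.
move=> i j; transitivity (T i j).
  rewrite (bigD1 j) //= (lconv_matrix1 H cL) eqxx mulr1 big1 ?addr0 // => k /negPf kj.
  by rewrite (lconv_matrix1 H cL) kj mulr0.
rewrite (bigD1 i) //= (rconv_matrix1 H cL) eqxx mul1r big1 ?addr0 // => k /negPf ki.
by rewrite (rconv_matrix1 H cL) eq_sym ki mul0r.
Qed.

Lemma intertwinesZ c a : intertwines a -> intertwines (c *: a).
Proof.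
move=> ta i j.
under eq_bigr do rewrite (linZ (lconv_linear H _)) -scalerAr.
under [RHS]eq_bigr do rewrite (linZ (rconv_linear H _)) -scalerAl.
by rewrite -!scaler_sumr ta.
Qed.

Lemma intertwinesD a b : intertwines a -> intertwines b -> intertwines (a + b).
Proof.
move=> ta tb i j.
under eq_bigr do rewrite (linD (lconv_linear H _)) mulrDr.
under [RHS]eq_bigr do rewrite (linD (rconv_linear H _)) mulrDl.
by rewrite !big_split /= ta tb.
Qed.

Lemma intertwinesM a b : intertwines a -> intertwines b -> intertwines (a * b).
Proof.
move=> ta tb i j.
transitivity (\sum_k \sum_l T i l * lconv H (L l k) a * lconv H (L k j) b).
  under eq_bigr do rewrite (lconv_matrixM H cL) mulr_sumr.
  by rewrite exchange_big; apply: eq_bigr => k _; apply: eq_bigr => l _; rewrite mulrA.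
transitivity (\sum_k \sum_l rconv H (L i l) a * (T l k * lconv H (L k j) b)).
  apply: eq_bigr => k _; rewrite -mulr_suml ta mulr_suml.
  by apply: eq_bigr => l _; rewrite mulrA.
rewrite exchange_big /=; under eq_bigr => l _ do rewrite -mulr_sumr tb mulr_sumr.
rewrite exchange_big; apply: eq_bigr => k _ /=.
by rewrite (rconv_matrixM H cL) mulr_suml; apply: eq_bigr => l _; rewrite mulrA.
Qed.

(* R(b) T = R(b) T L(a) L(b) = R(b) R(a) T L(b) = T L(b) *)
Lemma intertwinesV a b : a * b = 1 -> b * a = 1 -> intertwines a -> intertwines b.
Proof.
move=> ab ba ta i j.
have Lab k l : \sum_m lconv H (L k m) a * lconv H (L m l) b = (k == l)%:R.
  by rewrite -(lconv_matrixM H cL) ab (lconv_matrix1 H cL).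
have Rba k l : \sum_m rconv H (L k m) b * rconv H (L m l) a = (k == l)%:R.
  by rewrite -(rconv_matrixM H cL) ba (rconv_matrix1 H cL).
transitivity (\sum_k \sum_l \sum_m
    rconv H (L i k) b * rconv H (L k l) a * T l m * lconv H (L m j) b).
  transitivity (\sum_m \sum_l (\sum_k rconv H (L i k) b * rconv H (L k l) a)
                               * T l m * lconv H (L m j) b).
    apply: eq_bigr => m _; rewrite (bigD1 i) //= Rba eqxx mul1r big1 ?addr0 // => l.
    by rewrite eq_sym Rba => /negPf ->; rewrite !mul0r.
  under eq_bigr do under eq_bigr do rewrite !mulr_suml.
  rewrite exchange_big /=; under eq_bigr do rewrite exchange_big /=.
  by rewrite exchange_big.
apply: eq_bigr => k _.
transitivity (\sum_l \sum_m rconv H (L i k) b * (T k l * lconv H (L l m) a)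
                             * lconv H (L m j) b).
  rewrite exchange_big [RHS]exchange_big; apply: eq_bigr => m _ /=.
  rewrite -!mulr_suml -mulr_sumr ta mulr_sumr.
  by congr (_ * _); apply: eq_bigr => l _; rewrite mulrA.
transitivity (\sum_l rconv H (L i k) b * T k l * (l == j)%:R).
  apply: eq_bigr => l _; rewrite -Lab mulr_sumr.
  by apply: eq_bigr => m _; rewrite !mulrA.
rewrite (bigD1 j) //= eqxx mulr1 big1 ?addr0 // => l /negPf ->.
exact: mulr0.
Qed.

End Intertwining.

(** * The relation between $f$ and $M$ over the full index set *)

Section BicovarianceRelation.
Variables (K : fieldType) (A : algType K) (H : hopf_structure A) (I : finType).
Variables (T : I -> I -> A) (Lp Lm : I -> I -> {scalar A}).
Hypotheses (cLp : matrix_functional Lp) (cLm : matrix_functional Lm).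
Hypothesis cT : comatrix H T.
Hypothesis Lp_intertwines : forall a, intertwines H T Lp a.
Hypothesis Lm_intertwines : forall a, intertwines H T Lm a.
Local Notation kap := (antipode H).
Local Notation lam i j := (antipode_scalar H (Lp i j)).

(* The relation for [Lp] at [rconv (lam i k) (lconv (lam l j) a)], summed over [k] and [l]. *)
Lemma antipode_intertwines i j a :
  \sum_k T k j * rconv H (lam i k) a = \sum_k lconv H (lam k j) a * T i k.
Proof.
transitivity (\sum_k \sum_l \sum_m
    T k m * lconv H (Lp m l) (lconv H (lam l j) (rconv H (lam i k) a))).
  apply: eq_bigr => k _; rewrite exchange_big /=.
  have E m : \sum_l lconv H (Lp m l) (lconv H (lam l j) (rconv H (lam i k) a))
    = (m == j)%:R *: rconv H (lam i k) a.
    by apply: sum_lconv_counit => y; exact: conv_antipode_r.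
  under [RHS]eq_bigr do rewrite -mulr_sumr E.
  rewrite (bigD1 j) //= eqxx scale1r big1 ?addr0 // => m /negPf ->.
  by rewrite scale0r mulr0.
under eq_bigr do under eq_bigr do rewrite Lp_intertwines.
rewrite exchange_big /=; apply: eq_bigr => l _; rewrite exchange_big /=.
have E m : \sum_k rconv H (Lp k m) (rconv H (lam i k) (lconv H (lam l j) a))
    = (i == m)%:R *: lconv H (lam l j) a.
  by apply: sum_rconv_counit => y; exact: conv_antipode_l.
transitivity (\sum_m (i == m)%:R *: lconv H (lam l j) a * T m l).
  apply: eq_bigr => m _; rewrite -E mulr_suml.
  by apply: eq_bigr => k _; rewrite lconv_rconv.
rewrite (bigD1 i) //= eqxx scale1r big1 ?addr0 // => m.
by rewrite eq_sym => /negPf ->; rewrite scale0r mul0r.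
Qed.

(** Multiply $T\,(L^-*a)=(a*L^-)\,T$ on both sides by $\kappa(T)$, the inverse matrix of $T$. *)
Lemma intertwines_antipode i j a :
  \sum_k kap (T i k) * rconv H (Lm k j) a = \sum_k lconv H (Lm i k) a * kap (T k j).
Proof.
transitivity (\sum_k \sum_l \sum_m
    kap (T i k) * (rconv H (Lm k l) a * T l m) * kap (T m j)).
  apply: eq_bigr => k _.
  transitivity (\sum_l kap (T i k) * rconv H (Lm k l) a * (l == j)%:R).
    rewrite (bigD1 j) //= eqxx mulr1 big1 ?addr0 // => l /negPf ->.
    exact: mulr0.
  apply: eq_bigr => l _; rewrite -(comatrix_antipoder cT) mulr_sumr.
  by apply: eq_bigr => m _; rewrite !mulrA.
transitivity (\sum_m \sum_l \sum_k
    kap (T i k) * (T k l * lconv H (Lm l m) a) * kap (T m j)).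
  rewrite exchange_big; under eq_bigr do rewrite exchange_big /=; rewrite exchange_big /=.
  apply: eq_bigr => m _; rewrite exchange_big [RHS]exchange_big; apply: eq_bigr => k _ /=.
  by rewrite -!mulr_suml -!mulr_sumr Lm_intertwines.
apply: eq_bigr => m _.
transitivity (\sum_l (i == l)%:R * lconv H (Lm l m) a * kap (T m j)).
  apply: eq_bigr => l _; rewrite -(comatrix_antipodel cT) !mulr_suml.
  by apply: eq_bigr => k _; rewrite !mulrA.
rewrite (bigD1 i) //= eqxx mul1r big1 ?addr0 // => l.
by rewrite eq_sym => /negPf ->; rewrite !mul0r.
Qed.

(* [f] and [M] of the theorem, with all four indices in the index set of [T]. *)
Definition adjoint_functional (i j : I * I) : {scalar A} :=
  conv_scalar H (lam j.1 i.1) (Lm i.2 j.2).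

Definition adjoint_comatrix (j i : I * I) : A := T j.1 i.1 * kap (T i.2 j.2).

(** The antipode reverses products and the transposed indices of [Lp] reverse them back, so $\kappa'
    L^+$ with indices transposed is again multiplicative. Its convolution with $L^-$ is a tensor
    product of representations. *)
Lemma adjoint_functional_matrix : matrix_functional adjoint_functional.
Proof.
split=> [[i1 i2] [j1 j2]|[i1 i2] [j1 j2] a b].
  rewrite conv_scalar1 (antipode_scalar1 H cLp) cLm.1 /= xpair_eqE eq_sym.
  by rewrite -natrM mulnb.
rewrite /= /conv comulM.
have bc i j := conv_bilin (lam j.1 i.1) (Lm i.2 j.2).
have lc i j := tlift_linear (bc i j).
have bm := mul_bilin A.
move: (comul H a) (comul H b).
apply: (tmul_ext (bilin_post (lc (i1, i2) (j1, j2)) (tmul_bilin bm bm))) => [|x1 y1 x2 y2].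
  apply: bilin_bigsum => k.
  exact: (bilin_comp (mul_bilin K^o) (lc (i1, i2) k) (lc k (j1, j2))).
rewrite (tmul_tens bm bm) (tlift_tens (bc (i1, i2) (j1, j2))) /=.
transitivity (\sum_k \sum_l (Lp j1 k (kap x2) * Lm l j2 y2)
                              * (Lp k i1 (kap x1) * Lm i2 l y1)).
  rewrite antipodeM cLp.2 cLm.2 mulr_suml; apply: eq_bigr => k _.
  rewrite mulr_sumr; apply: eq_bigr => l _.
  by rewrite [Lm i2 l y1 * _]mulrC mulrACA.
rewrite pair_bigA; apply: eq_bigr => k _ /=.
by rewrite (tlift_tens (bc (i1, i2) k)) (tlift_tens (bc k (j1, j2))) /= mulrC.
Qed.

(** Since $f*a=\kappa' L^+*(L^-*a)$, the factor $T$ can pass $\kappa' L^+$ first. Left and right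
    convolutions commute, so $\kappa(T)$ can then pass $L^-$. *)
Lemma adjoint_relation i l a :
  \sum_j lconv H (adjoint_functional i j) a * adjoint_comatrix l j
  = \sum_k adjoint_comatrix k i * rconv H (adjoint_functional k l) a.
Proof.
case: i l => [i1 i2] [l1 l2].
transitivity (\sum_n \sum_m lconv H (lam m i1) (lconv H (Lm i2 n) a)
                              * T l1 m * kap (T n l2)).
  rewrite exchange_big pair_bigA; apply: eq_bigr => j _ /=.
  by rewrite -lconv_comp mulrA.
transitivity (\sum_n \sum_m T m i1 * lconv H (Lm i2 n) (rconv H (lam l1 m) a)
                              * kap (T n l2)).
  apply: eq_bigr => n _; rewrite -!mulr_suml -antipode_intertwines.
  by congr (_ * _); apply: eq_bigr => m _; rewrite lconv_rconv.
transitivity (\sum_m \sum_n T m i1 * (kap (T i2 n)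
                              * rconv H (Lm n l2) (rconv H (lam l1 m) a))).
  rewrite exchange_big; apply: eq_bigr => m _ /=.
  under eq_bigr do rewrite -mulrA.
  by rewrite -!mulr_sumr intertwines_antipode.
rewrite pair_bigA; apply: eq_bigr => k _ /=.
by rewrite rconv_comp mulrA.
Qed.
End BicovarianceRelation.

(** * Comatrices, Hopf morphisms and the inverse R-matrix *)

Section AdjointComatrix.
Variables (K : fieldType) (A : algType K) (H : hopf_structure A) (I J : finType).
Variables (T : I -> I -> A) (U : J -> J -> A).
Hypotheses (cT : comatrix H T) (cU : comatrix H U).

(** The tensor product of the corepresentation [T] with the contragredient of [U]. Two index types
    occur because the first index of $M$ runs over $0,\dots,N$ and the second over $1,\dots,N$. *)
Lemma adjoint_comatrixP :
  comatrix H (fun j i : I * J => T j.1 i.1 * antipode H (U i.2 j.2)).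
Proof.
have bm := mul_bilin A; have bt := tmul_bilin bm bm.
split=> [[j1 j2] [i1 i2]|[j1 j2] [i1 i2]] /=; last first.
  rewrite counitM cT.2 (counit_comatrix_antipode cU) -natrM mulnb xpair_eqE.
  by rewrite [i2 == j2]eq_sym.
rewrite comulM cT.1 (comul_comatrix_antipode cU).
apply: (etrans (lin_sum _ (bilin_l _ bt))).
transitivity (\sum_c \sum_k (T j1 c * antipode H (U k j2))
                \ox (T c i1 * antipode H (U i2 k))).
  apply: eq_bigr => c _.
  apply: (etrans (lin_sum _ (bilin_r (T j1 c \ox T c i1) bt))).
  by apply: eq_bigr => k _; exact (tmul_tens bm bm (T j1 c) (T c i1)
    (antipode H (U k j2)) (antipode H (U i2 k))).
exact: (pair_bigA _ (fun c k => (T j1 c * antipode H (U k j2))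
                \ox (T c i1 * antipode H (U i2 k)))).
Qed.

Lemma lconv_comatrix (g : {scalar A}) i j :
  lconv H g (T i j) = \sum_k g (T k j) *: T i k.
Proof.
have b := scale_r_bilin A (scalar_linear g).
rewrite /lconv cT.1; apply: (etrans (lin_sum _ (tlift_linear b))).
by apply: eq_bigr => k _; exact: (tlift_tens b).
Qed.

Lemma rconv_comatrix (g : {scalar A}) i j :
  rconv H g (T i j) = \sum_k g (T i k) *: T k j.
Proof.
have b := scale_l_bilin A (scalar_linear g).
rewrite /rconv cT.1; apply: (etrans (lin_sum _ (tlift_linear b))).
by apply: eq_bigr => k _; exact: (tlift_tens b).
Qed.

Lemma conv_comatrix (f g : {scalar A}) i j :
  conv H f g (T i j) = \sum_k f (T i k) * g (T k j).
Proof.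
have b := conv_bilin f g.
rewrite /conv cT.1; apply: (etrans (lin_sum _ (tlift_linear b))).
by apply: eq_bigr => k _; exact: (tlift_tens b).
Qed.

End AdjointComatrix.

Section HopfProjection.
Variables (K : fieldType) (A B : algType K).
Variables (HA : hopf_structure A) (HB : hopf_structure B) (p : A -> B).
Hypotheses (Hp : is_hopf_morphism HA HB p) (lp : linear p).

Lemma lconv_morph (F : {scalar A}) (f : {scalar B}) a :
  (forall x, f (p x) = F x) -> lconv HB f (p a) = p (lconv HA F a).
Proof.
move=> fp; have b := scale_r_bilin B (scalar_linear f).
have b' := scale_r_bilin A (scalar_linear F).
rewrite /lconv (hopf_comul Hp) (tlift_tmap _ b lp lp) (lin_tlift _ lp b').
apply: (tlift_eq _ (bilin_comp b lp lp) (bilin_post lp b')) => x y.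
by rewrite fp (linZ lp).
Qed.

Lemma rconv_morph (F : {scalar A}) (f : {scalar B}) a :
  (forall x, f (p x) = F x) -> rconv HB f (p a) = p (rconv HA F a).
Proof.
move=> fp; have b := scale_l_bilin B (scalar_linear f).
have b' := scale_l_bilin A (scalar_linear F).
rewrite /rconv (hopf_comul Hp) (tlift_tmap _ b lp lp) (lin_tlift _ lp b').
apply: (tlift_eq _ (bilin_comp b lp lp) (bilin_post lp b')) => x y.
by rewrite fp (linZ lp).
Qed.

Lemma comatrix_morph (I : finType) (T : I -> I -> A) :
  comatrix HA T -> comatrix HB (fun i j => p (T i j)).
Proof.
move=> cT; split=> i j; last by rewrite (hopf_counit Hp) cT.2.
rewrite (hopf_comul Hp) cT.1; apply: (etrans (lin_sum _ (tmap_linear lp lp))).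
by apply: eq_bigr => k _; exact: (tmap_tens _ _ lp lp).
Qed.

End HopfProjection.

Section QuotientFunctional.
Variables (K : fieldType) (A : algType K) (I : ideal A) (F : {scalar A}).
Hypothesis F0 : forall x, I x -> F x = 0.

Definition aquot_scalar_fun (x : aquot I) : K := F (lrepr x).

Lemma aquot_scalar_funE a : aquot_scalar_fun (aproj I a) = F a.
Proof.
apply/eqP; rewrite -subr_eq0 -linearB; apply/eqP/F0.
by apply/(lprojP I); rewrite lreprK.
Qed.

Lemma aquot_scalar_fun_linear : scalar aquot_scalar_fun.
Proof.
move=> c x y; rewrite -[x]aproj_surj -[y]aproj_surj -linearP !aquot_scalar_funE.
exact: linearP.
Qed.

Definition aquot_scalar : {scalar aquot I} :=
  HB.pack aquot_scalar_fun
    (GRing.isLinear.Build K (aquot I) K *%R aquot_scalar_fun aquot_scalar_fun_linear).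

End QuotientFunctional.

(** * The inverse of the R-matrix in closed form *)

Section RMatrixInverse.
Variables (K : fieldType) (N : nat).
Local Notation I := 'I_N.+1.

Lemma Rmat_sum (V : lmodType K) (r : K) (q : I -> I -> K) A B (g : I -> I -> V) :
  \sum_E \sum_F Rmat r q A B E F *: g E F
  = (r / q A B + (r - 1) * (A == B)%:R) *: g A B
    + ((r - r^-1) * (B < A)%:R) *: g B A.
Proof.
pose d := r / q A B + (r - 1) * (A == B)%:R; pose e := (r - r^-1) * (B < A)%:R.
transitivity (\sum_E \sum_F (((A == E) && (B == F))%:R * d) *: g E F
              + \sum_E \sum_F (((B == E) && (A == F))%:R * e) *: g E F).
  rewrite -big_split; apply: eq_bigr => E _; rewrite -big_split; apply: eq_bigr => F _ /=.
  rewrite -scalerDl /Rmat; congr (_ *: _); congr (_ + _).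
  by rewrite andbC mulrAC [RHS]mulrC /e mulrAC.
have S c X Y : \sum_E \sum_F (((X == E) && (Y == F))%:R * c) *: g E F = c *: g X Y.
  rewrite (bigD1 X) //= [X in _ + X]big1 ?addr0 => [|E /negPf EX]; last first.
    by rewrite big1 // => F _; rewrite eq_sym EX mul0r scale0r.
  rewrite (bigD1 Y) //= big1 ?addr0 => [|F /negPf FY]; last first.
    by rewrite [Y == F]eq_sym FY andbF mul0r scale0r.
  by rewrite !eqxx mul1r.
by rewrite !S.
Qed.

(** $R$ preserves the span of the pairs $AB$ and $BA$. For $A=B$ the entry is $r$. For $A\ne B$ the
    block is triangular with diagonal entries $r/q_{AB}$ and $r/q_{BA}$ of product 1, so inversion
    inverts them and changes the sign of $r-r^{-1}$; inverting all parameters does exactly this. *)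
Lemma Rmat_inverse (r : K) (q : I -> I -> K) (r_neq0 : r != 0)
    (q_neq0 : forall A B, q A B != 0) (q_inv : forall A B, q A B = r ^+ 2 / q B A)
    (q_diag : forall A, q A A = r) A B C D :
  \sum_E \sum_F Rmat r q A B E F * Rmat r^-1 (fun A B => (q A B)^-1) E F C D
  = ((A == C) && (B == D))%:R.
Proof.
rewrite (Rmat_sum (V := K^o) r q A B (fun E F => Rmat r^-1 (fun A B => (q A B)^-1) E F C D)).
rewrite /Rmat /GRing.scale /= !invrK.
case: (ltngtP B A) => [BA|AB|/val_inj BA].
- have nAB : A == B = false by rewrite -val_eqE gtn_eqF.
  rewrite nAB [B == A]eq_sym nAB (q_inv A B) ![_ && (_ == C)]andbC.
  have := q_neq0 B A; move: (q B A) (_ && _)%:R (_ && _)%:R => b x y b_neq0 /=.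
  by field; rewrite r_neq0.
- have nAB : A == B = false by rewrite -val_eqE ltn_eqF.
  rewrite nAB; have := q_neq0 A B; move: (q A B) (q B A) (_ && _)%:R => a b x a_neq0 /=.
  by field; rewrite r_neq0.
subst B; rewrite q_diag eqxx.
move: (_ && _)%:R => x /=.
by field.
Qed.

End RMatrixInverse.

(** * The functionals L on GL *)

(** From $RX=YR$ to $XR'=R'Y$, by multiplying with the inverse $R'$ on both sides. *)
Lemma conjugate_relation (K : fieldType) (V : lmodType K) (J : finType)
    (R R' : J -> J -> K) (X Y : J -> J -> V) :
  (forall i k, \sum_j R i j * R' j k = (i == k)%:R) ->
  (forall i k, \sum_j R' i j * R j k = (i == k)%:R) ->
  (forall i k, \sum_j R i j *: X j k = \sum_j R j k *: Y i j) ->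
  forall i k, \sum_j R' j k *: X i j = \sum_j R' i j *: Y j k.
Proof.
move=> RR' R'R RX i k.
transitivity (\sum_j \sum_m \sum_l (R' m k * R' i j * R j l) *: X l m).
  rewrite exchange_big; apply: eq_bigr => m _ /=; rewrite exchange_big.
  under eq_bigr => l _.
    rewrite -scaler_suml; under eq_bigr do rewrite -mulrA.
    rewrite -mulr_sumr R'R.
    over.
  rewrite (bigD1 i) //= eqxx mulr1 big1 ?addr0 // => l.
  by rewrite eq_sym => /negPf ->; rewrite mulr0 scale0r.
apply: eq_bigr => j _.
transitivity (\sum_m \sum_l (R' m k * R' i j * R l m) *: Y j l).
  apply: eq_bigr => m _; under eq_bigr do rewrite -scalerA.
  by rewrite -scaler_sumr RX scaler_sumr; apply: eq_bigr => l _; rewrite scalerA.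
have E l : \sum_m R' m k * R' i j * R l m = R' i j * (l == k)%:R.
  rewrite -RR' mulr_sumr; apply: eq_bigr => m _.
  by rewrite mulrAC mulrC [R' m k * _]mulrC.
rewrite exchange_big /=; under eq_bigr do rewrite -scaler_suml E.
rewrite (bigD1 k) //= eqxx mulr1 big1 ?addr0 // => l /negPf ->.
by rewrite mulr0 scale0r.
Qed.

Section GeneralLinear.
Variables (K : fieldType) (N : nat) (r : K) (q : 'I_N.+1 -> 'I_N.+1 -> K).
Hypotheses (r_neq0 : r != 0) (q_neq0 : forall A B, q A B != 0).
Hypotheses (q_inv : forall A B, q A B = r ^+ 2 / q B A) (q_diag : forall A, q A A = r).
Local Notation I := 'I_N.+1.
Local Notation qV := (fun A B => (q A B)^-1).
Local Notation T := (GL_T r q).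

(** A one-sided inverse of a square matrix already determines [invmx]. The explicit entries are
    needed to see which values of $L^-$ vanish. *)
Lemma RinvE A B C D : Rinv r q A B C D = Rmat r^-1 qV A B C D.
Proof.
pose S : 'M[K]_#|{: I * I}| := \matrix_(i, j)
  Rmat r^-1 qV (enum_val i).1 (enum_val i).2 (enum_val j).1 (enum_val j).2.
have RS : Rmx r q *m S = 1%:M.
  apply/matrixP => i j; rewrite !mxE (reindex (@enum_rank _)) /=; last first.
    exact/onW_bij/enum_rank_bij.
  under eq_bigr do rewrite !mxE enum_rankK.
  rewrite -(pair_bigA _ (fun E F => Rmat r q (enum_val i).1 (enum_val i).2 E F
    * Rmat r^-1 qV E F (enum_val j).1 (enum_val j).2)) /=.
  rewrite (Rmat_inverse r_neq0 q_neq0 q_inv q_diag) -xpair_eqE -!surjective_pairing.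
  by rewrite (inj_eq enum_val_inj).
have [Ru _] := mulmx1_unit RS.
rewrite /Rinv (_ : invmx (Rmx r q) = S); first by rewrite mxE !enum_rankK.
by rewrite -[LHS]mulmx1 -RS mulmxA mulVmx // mul1mx.
Qed.

(** The conditions on the parameters survive inverting all of them, so [Rmat_inverse] at the
    inverted parameters is the product in the other order. *)
Lemma Rinv_inverse A B C D :
  \sum_E \sum_F Rinv r q A B E F * Rmat r q E F C D = ((A == C) && (B == D))%:R.
Proof.
have qiV A' B' : (q A' B')^-1 = r^-1 ^+ 2 / (q B' A')^-1.
  by rewrite q_inv invf_div invrK exprVn mulrC.
rewrite -(Rmat_inverse (r := r^-1) (q := qV) _ _ qiV) => [|||A']; last by rewrite q_diag.
- apply: eq_bigr => E _; apply: eq_bigr => F _; rewrite RinvE; congr (_ * _).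
  by rewrite /Rmat !invrK.
- by rewrite invr_eq0.
- by move=> A' B'; rewrite invr_eq0.
Qed.

Lemma Rmat_Rinv A B C D :
  \sum_E \sum_F Rmat r q A B E F * Rinv r q E F C D = ((A == C) && (B == D))%:R.
Proof.
rewrite -(Rmat_inverse r_neq0 q_neq0 q_inv q_diag).
by apply: eq_bigr => E _; apply: eq_bigr => F _; rewrite RinvE.
Qed.

(** With pairs of indices as single indices, $R\,T_1T_2=T_2T_1\,R$ is turned into
    $T_1T_2\,R^{-1}=R^{-1}\,T_2T_1$, the form that fits $L^-$. *)
Lemma RTT_Rinv (Q : algType K) (U : I -> I -> Q) :
  (forall A B C D, \sum_E \sum_F Rmat r q A B E F *: (U E C * U F D)
     = \sum_E \sum_F Rmat r q E F C D *: (U B F * U A E)) ->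
  forall A B C D,
  \sum_E \sum_F Rinv r q E F C D *: (U A E * U B F)
  = \sum_E \sum_F Rinv r q A B E F *: (U F D * U E C).
Proof.
move=> RTT A B C D.
pose R (i j : I * I) := Rmat r q i.1 i.2 j.1 j.2.
pose R' (i j : I * I) := Rinv r q i.1 i.2 j.1 j.2.
pose X (i j : I * I) := U i.1 j.1 * U i.2 j.2.
pose Y (i j : I * I) := U i.2 j.2 * U i.1 j.1.
have RX i k : \sum_j R i j *: X j k = \sum_j R j k *: Y i j.
  rewrite -(pair_bigA _ (fun E F => R i (E, F) *: X (E, F) k)).
  by rewrite -(pair_bigA _ (fun E F => R (E, F) k *: Y i (E, F))) RTT.
have RR' i k : \sum_j R i j * R' j k = (i == k)%:R.
  rewrite -(pair_bigA _ (fun E F => R i (E, F) * R' (E, F) k)) Rmat_Rinv.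
  by rewrite -xpair_eqE -!surjective_pairing.
have R'R i k : \sum_j R' i j * R j k = (i == k)%:R.
  rewrite -(pair_bigA _ (fun E F => R' i (E, F) * R (E, F) k)) Rinv_inverse.
  by rewrite -xpair_eqE -!surjective_pairing.
have := conjugate_relation RR' R'R RX (A, B) (C, D).
rewrite -(pair_bigA _ (fun E F => R' (E, F) (C, D) *: X (A, B) (E, F))).
by rewrite -(pair_bigA _ (fun E F => R' (A, B) (E, F) *: Y (E, F) (C, D))).
Qed.

Variables (H : hopf_structure (GL r q)) (HG : is_GL_hopf H).

Lemma GL_comatrix : comatrix H T.
Proof. by split; [exact: (GL_comulT HG)|exact: (GL_counitT HG)]. Qed.

Lemma L_functional_matrix v L : is_L_functional (r := r) (q := q) v L -> matrix_functional L.
Proof. by move=> HL; split; [exact: (L_1 HL)|exact: (L_M HL)]. Qed.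

Lemma GL_intertwines (L : I -> I -> {scalar GL r q}) :
  matrix_functional L -> (forall C D, intertwines H T L (T C D)) ->
  forall a, intertwines H T L a.
Proof.
move=> cL LT; apply: (GL_ind (P := intertwines H T L)) => [|C D|c a|a b|a b|a b].
- exact: intertwines1.
- exact: LT.
- exact: intertwinesZ.
- exact: intertwinesD.
- exact: intertwinesM.
- exact: intertwinesV.
Qed.

(** At $T^C{}_D$ the two convolutions expand by the coproduct of $T$ into [cp] times the two sides
    of the RTT relation. *)
Lemma Lp_intertwines cp Lp :
  is_L_functional (fun A B C D => cp * Rmat r q C A D B) Lp ->
  forall a, intertwines H T Lp a.
Proof.
move=> HL; apply: GL_intertwines => [|C D A B]; first exact: L_functional_matrix HL.
transitivity (cp *: \sum_E \sum_F Rmat r q E F D B *: (T A F * T C E)).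
  rewrite exchange_big scaler_sumr; apply: eq_bigr => F _ /=.
  rewrite (lconv_comatrix GL_comatrix) mulr_sumr scaler_sumr.
  by apply: eq_bigr => E _; rewrite (L_T HL) -scalerAr scalerA.
rewrite -GL_RTT_rel exchange_big scaler_sumr; apply: eq_bigr => F _ /=.
rewrite (rconv_comatrix GL_comatrix) mulr_suml scaler_sumr.
by apply: eq_bigr => E _; rewrite (L_T HL) -scalerAl scalerA.
Qed.

Lemma Lm_intertwines cm Lm :
  is_L_functional (fun A B C D => cm * Rinv r q A C B D) Lm ->
  forall a, intertwines H T Lm a.
Proof.
move=> HL; apply: GL_intertwines => [|C D A B]; first exact: L_functional_matrix HL.
transitivity (cm *: \sum_E \sum_F Rinv r q E F B D *: (T A E * T C F)).
  rewrite scaler_sumr; apply: eq_bigr => E _ /=.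
  rewrite (lconv_comatrix GL_comatrix) mulr_sumr scaler_sumr.
  by apply: eq_bigr => F _; rewrite (L_T HL) -scalerAr scalerA.
rewrite (RTT_Rinv (@GL_RTT_rel K N r q)) scaler_sumr; apply: eq_bigr => E _ /=.
rewrite (rconv_comatrix GL_comatrix) mulr_suml scaler_sumr.
by apply: eq_bigr => F _; rewrite (L_T HL) -scalerAl scalerA.
Qed.
End GeneralLinear.

(** * Descent to IGL *)

Lemma ffun_free_module (K : fieldType) (A : algType K) (I : finType) :
  free_module (G := {ffun I -> A}) (fun (a : A) (g : {ffun I -> A}) => [ffun i => a * g i])
    (fun i => [ffun j => (i == j)%:R]) (fun i g => g i).
Proof.
split=> [|g|a b g|i c g h|i a g|i j|g].
- split=> [g c a b|a c g h]; apply/ffunP => i; rewrite !ffunE.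
    by rewrite mulrDl scalerAl.
  by rewrite mulrDr scalerAr.
- by apply/ffunP => i; rewrite ffunE mul1r.
- by apply/ffunP => i; rewrite !ffunE mulrA.
- by rewrite !ffunE.
- by rewrite ffunE.
- by rewrite ffunE.
- apply/ffunP => j; rewrite sum_ffunE (bigD1 j) //= big1 => [|i /negPf ij].
    by rewrite !ffunE eqxx mulr1 addr0.
  by rewrite !ffunE ij mulr0.
Qed.

(** The passage from second indices in $0,\dots,N$ to $1,\dots,N$: it applies whenever the terms at
    0 vanish. *)
Lemma sum_up (V : zmodType) (N : nat) (g : 'I_N.+1 * 'I_N.+1 -> V) :
  (forall B, g (B, ord0) = 0) -> \sum_j g j = \sum_(j : Idx N) g (j.1, up j.2).
Proof.
move=> g0; rewrite (eq_bigr (fun p => g (p.1, p.2))) => [|[] //].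
rewrite -(pair_bigA _ (fun a b => g (a, b))) -(pair_bigA _ (fun a b => g (a, up b))).
by apply: eq_bigr => a _; rewrite big_ord_recl g0 /= add0r.
Qed.

Section InhomogeneousGeneralLinear.
Variables (K : fieldType) (N : nat) (r : K) (q : 'I_N.+1 -> 'I_N.+1 -> K) (cp cm : K).
Hypotheses (r_neq0 : r != 0) (q_neq0 : forall A B, q A B != 0).
Hypotheses (q_inv : forall A B, q A B = r ^+ 2 / q B A) (q_diag : forall A, q A A = r).
Hypotheses (cp_neq0 : cp != 0).
Local Notation I := 'I_N.+1.
Local Notation T := (GL_T r q).
Local Notation P := (@IGL_P K N r q).
Variables (H : hopf_structure (GL r q)) (HG : is_GL_hopf H).
Variables (HI : hopf_structure (IGL r q)) (HP : is_hopf_morphism H HI P).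
Variables (Lp Lm : I -> I -> {scalar GL r q}).
Hypothesis HLp : is_L_functional (fun A B C D => cp * Rmat r q C A D B) Lp.
Hypothesis HLm : is_L_functional (fun A B C D => cm * Rinv r q A C B D) Lm.
Let cLp := L_functional_matrix HLp.
Let cLm := L_functional_matrix HLm.
Let cT := GL_comatrix HG.
Local Notation kap := (antipode H).

Lemma up_neq0 (b : 'I_N) : (ord0 == up b) = false.
Proof. by rewrite eq_sym. Qed.

(** On generators, $(R^{-1})^{0C}{}_{bD}=0$: the diagonal part needs $0=b$ and the other part $C<0$.
    For an inverse $y$ of $x$, vanishing on $x$ gives $L^0{}_c(xy)=L^0{}_0(x)L^0{}_c(y)$; the case
    $c=0$ shows $L^0{}_0(x)\ne0$, and the case $c=b$ then kills $L^0{}_b(y)$. *)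
Lemma Lm_row0 b a : Lm ord0 (up b) a = 0.
Proof.
have Rec x y c : Lm ord0 c (x * y) = Lm ord0 ord0 x * Lm ord0 c y
    + \sum_d Lm ord0 (up d) x * Lm (up d) c y.
  by rewrite (L_M HLm) big_ord_recl.
move: a b; apply: GL_ind => [b|C D b|c a a0 b|a a' a0 a'0 b|a a' a0 a'0 b|x y xy _ x0 b].
- by rewrite (L_1 HLm) up_neq0.
- rewrite (L_T HLm) (RinvE r_neq0 q_neq0 q_inv q_diag) /Rmat up_neq0 ltn0 /=.
  by rewrite mul0r mulr0 addr0 mulr0.
- by rewrite scalarZ a0 mulr0.
- by rewrite linearD /= a0 a'0 addr0.
- by rewrite Rec a'0 mulr0 big1 ?addr0 // => d _; rewrite a0 mul0r.
have R0 c : Lm ord0 c (x * y) = Lm ord0 ord0 x * Lm ord0 c y.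
  by rewrite Rec big1 ?addr0 // => d _; rewrite x0 mul0r.
have := R0 (up b); rewrite xy (L_1 HLm) up_neq0 => /esym/eqP; rewrite mulf_eq0.
case/orP => [/eqP e|/eqP //]; have /eqP := R0 ord0.
by rewrite xy (L_1 HLm) e mul0r oner_eq0.
Qed.

(** Apply $L^{+A}{}_B$ to $\sum_C T^0{}_C\,\kappa(T^C{}_c)=0$. The coefficients are
    $c^+R^{0A}{}_{CD}$, nonzero only at $C=0$, $D=A$, where the value is $c^+ r$ or $c^+ r/q_{0A}$;
    it can be divided out. *)
Lemma Lp_antipode_T0 A B c : Lp A B (kap (T ord0 (up c))) = 0.
Proof.
have /(congr1 (Lp A B)) := comatrix_antipoder cT ord0 (up c).
rewrite up_neq0 linear0 linear_sum /=.
under eq_bigr do rewrite (L_M HLp).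
under eq_bigr do under eq_bigr do rewrite (L_T HLp) -mulrA.
under eq_bigr do rewrite -mulr_sumr.
rewrite -mulr_sumr.
rewrite (Rmat_sum (V := K^o) r q ord0 A (fun C D => Lp D B (kap (T C (up c))))).
rewrite ltn0 mulr0 scale0r addr0 => /eqP; rewrite mulf_eq0 (negPf cp_neq0) /=.
rewrite mulf_eq0 => /orP[|/eqP //]; have [<-|_] := eqVneq ord0 A.
  by rewrite q_diag divff // mulr1 addrC subrK (negPf r_neq0).
by rewrite mulr0 addr0 mulf_eq0 invr_eq0 (negPf r_neq0) (negPf (q_neq0 _ _)).
Qed.

Definition fGL (i j : Idx N) : {scalar GL r q} :=
  adjoint_functional H Lp Lm (i.1, up i.2) (j.1, up j.2).

(** In the coproduct of $T^0{}_c$ the terms with middle index positive die by [Lp_antipode_T0]. The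
    term with middle index 0 carries $(R^{-1})^{a_2 0}{}_{b_2 c}$, which vanishes because $c$ and
    $b_2$ are positive. *)
Lemma fGL_T0 i j c : fGL i j (T ord0 (up c)) = 0.
Proof.
rewrite /= (conv_comatrix cT) big1 // => C _ /=.
case: (unliftP ord0 C) => [d|] ->; first by rewrite Lp_antipode_T0 mul0r.
rewrite (L_T HLm) (RinvE r_neq0 q_neq0 q_inv q_diag) /Rmat !up_neq0 andbF andbF /=.
by rewrite !mul0r !(mulr0, mul0r) addr0 !mulr0.
Qed.

Lemma adjoint_functional_row0 A j x :
  adjoint_functional H Lp Lm (A, ord0) (j.1, up j.2) x = 0.
Proof. by apply: conv_zero_r => y; exact: Lm_row0. Qed.

(** Block triangularity: an entry leading from second index 0 to a positive one is zero, so
    intermediate indices 0 drop out of the product rule. *)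
Lemma fGL_matrix : matrix_functional fGL.
Proof.
have [F1 FM] := adjoint_functional_matrix H cLp cLm.
split=> [i j|i j a b].
  rewrite /fGL F1; case: i j => [i1 i2] [j1 j2] /=.
  by rewrite !xpair_eqE (inj_eq lift_inj).
rewrite /fGL FM sum_up // => B.
by rewrite adjoint_functional_row0 mulr0.
Qed.

Lemma fGL_ideal i j x : IGLideal r q x -> fGL i j x = 0.
Proof.
(* The indices stay general: the product rule for one entry involves all the others, so all entries
   must vanish together. *)
move=> Ix; move: i j; elim: x / Ix => [a [c]|i j|a b _ a0 _ b0 i j|c a _ a0 i j|c a _ a0 i j].
- by move=> i j; exact: fGL_T0.
- exact: linear0.
- by rewrite (linearD (fGL i j)) a0 b0 addr0.
- by rewrite fGL_matrix.2 big1 // => k _; rewrite a0 mulr0.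
- by rewrite fGL_matrix.2 big1 // => k _; rewrite a0 mul0r.
Qed.

Definition fIGL (i j : Idx N) : {scalar IGL r q} := aquot_scalar (@fGL_ideal i j).

Lemma fIGL_P i j a : fIGL i j (P a) = fGL i j a.
Proof. exact: (aquot_scalar_funE (@fGL_ideal i j) a). Qed.

Lemma fIGL_matrix : matrix_functional fIGL.
Proof.
have [F1 FM] := fGL_matrix; split=> [i j|i j x y].
  by rewrite -(rmorph1 (aproj (IGLideal r q))) fIGL_P F1.
rewrite -[x]aproj_surj -[y]aproj_surj -rmorphM fIGL_P FM.
by apply: eq_bigr => k _; rewrite !fIGL_P.
Qed.

Lemma P_T0 a : P (T ord0 (up a)) = 0.
Proof.
rewrite -(raddf0 (aproj (IGLideal r q))); apply/(lprojP (IGLideal r q)).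
by rewrite subr0; exact/ideal_gen/IGL_T0.
Qed.

Lemma P_linear : linear P.
Proof. exact: (linearP (aproj (IGLideal r q))). Qed.

Lemma IGL_comatrix : comatrix HI (fun A B => P (T A B)).
Proof. exact: (comatrix_morph HP P_linear cT). Qed.

(** The only term of the coproduct leaving the block is $T^a{}_0\otimes T^0{}_b$, and $T^0{}_b$ is
    zero in [IGL]. *)
Lemma IGL_up_comatrix : comatrix HI (fun a b => P (T (up a) (up b))).
Proof.
have [cD ce] := IGL_comatrix; split=> a b; last first.
  by rewrite ce (inj_eq lift_inj).
rewrite cD big_ord_recl P_T0 (lin0 (bilin_r _ (tens_bilin _ _))) add0r.
by [].
Qed.

Lemma M_IGL_comatrix : comatrix HI (M_IGL HI).
Proof. exact: (adjoint_comatrixP IGL_comatrix IGL_up_comatrix). Qed.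

Lemma M_IGLE (j i : Idx N) :
  M_IGL HI j i = P (adjoint_comatrix H T (j.1, up j.2) (i.1, up i.2)).
Proof. by rewrite /M_IGL (hopf_antipode HP) -(rmorphM (aproj (IGLideal r q))). Qed.

(** Project [adjoint_relation] to [IGL]. On the left a term with second index 0 contains
    $\kappa(T^0{}_{l_2})$, which projects to zero; on the right it contains a functional that is
    zero by [adjoint_functional_row0]. *)
Lemma IGL_relation i l x :
  \sum_j lconv HI (fIGL i j) x * M_IGL HI l j = \sum_k M_IGL HI k i * rconv HI (fIGL k l) x.
Proof.
rewrite -[x]aproj_surj; move: (lrepr x) => {x} a.
pose F := adjoint_functional H Lp Lm; pose M := adjoint_comatrix H T.
pose i' := (i.1, up i.2); pose l' := (l.1, up l.2).
have Pm x y : P (x * y) = P x * P y by exact: (rmorphM (aproj (IGLideal r q))).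
transitivity (P (\sum_j lconv H (F i' j) a * M l' j)).
  rewrite (lin_sum _ P_linear) sum_up => [|B].
    apply: eq_bigr => j _; rewrite Pm M_IGLE; congr (_ * _).
    by apply: (lconv_morph HP P_linear) => y; exact: fIGL_P.
  rewrite Pm /M /adjoint_comatrix Pm -(hopf_antipode HP) P_T0 linear0.
  by rewrite !mulr0.
rewrite (adjoint_relation cLp cT (Lp_intertwines HG HLp)
  (Lm_intertwines r_neq0 q_neq0 q_inv q_diag HG HLm)).
rewrite (lin_sum _ P_linear) sum_up => [|B].
  apply: eq_bigr => j _; rewrite Pm M_IGLE; congr (_ * _).
  by apply: esym; apply: (rconv_morph HP P_linear) => y; exact: fIGL_P.
rewrite rconv_zero ?mulr0 ?(lin0 P_linear) // => y.
exact: adjoint_functional_row0.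
Qed.

Lemma Gamma_free_module :
  free_module (@Gamma_lact K N r q) (omega r q) (fun i g => (g : {ffun Idx N -> IGL r q}) i).
Proof. exact: ffun_free_module. Qed.

Definition IGL_bimodule : bicovariant_bimodule HI (Gamma r q) :=
  free_bicovariant_bimodule Gamma_free_module fIGL_matrix M_IGL_comatrix IGL_relation.

Lemma Gamma_bicovariant_bimodule :
  exists (f : Idx N -> Idx N -> {scalar IGL r q})
         (G : bicovariant_bimodule HI (Gamma r q)),
    (forall i j a, f i j (IGL_P a) = f_GL H Lp Lm i j a) /\
    (forall a g, lact G a g = Gamma_lact a g) /\
    (forall i a, ract G (omega r q i) a
       = \sum_j Gamma_lact (lconv HI (f i j) a) (omega r q j)) /\
    (forall a : Idx N -> IGL r q,
       coactL G (\sum_i Gamma_lact (a i) (omega r q i))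
       = \sum_i tmul *%R (@Gamma_lact _ N r q) (comul HI (a i)) (1 \ox omega r q i)) /\
    (forall a : Idx N -> IGL r q,
       coactR G (\sum_i Gamma_lact (a i) (omega r q i))
       = \sum_i tmul (@Gamma_lact _ N r q) *%R (comul HI (a i))
                  (\sum_j omega r q j \ox M_IGL HI j i)).
Proof.
exists fIGL, IGL_bimodule.
split; first exact: fIGL_P.
split; first by move=> a g.
split; first exact: (fract_basis HI Gamma_free_module fIGL).
split=> a.
  apply: etrans (lin_sum _ (linearP (coactL IGL_bimodule))) _.
  apply: eq_bigr => i _; apply: etrans (free_coactL_act HI Gamma_free_module _ _) _.
  congr (tmul _ _ _ _); exact: (free_coactL_basis HI Gamma_free_module).
apply: etrans (lin_sum _ (linearP (coactR IGL_bimodule))) _.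
apply: eq_bigr => i _; apply: etrans (free_coactR_act HI Gamma_free_module _ _ _) _.
congr (tmul _ _ _ _); exact: (free_coactR_basis HI Gamma_free_module).
Qed.

End InhomogeneousGeneralLinear.

Theorem theorem3p5p2 (R : realType) (N : nat)
    (r : R[i]) (q : 'I_N.+1 -> 'I_N.+1 -> R[i]) (cp cm : R[i])
    (r_neq0 : r != 0) (q_neq0 : forall A B, q A B != 0)
    (q_inv : forall A B, q A B = r ^+ 2 / q B A) (q_diag : forall A, q A A = r)
    (cp_neq0 : cp != 0) (cm_neq0 : cm != 0)
    (HGL : hopf_structure (GL r q)) (HGL_std : is_GL_hopf HGL)
    (HIGL : hopf_structure (IGL r q))
    (HP : is_hopf_morphism HGL HIGL (@IGL_P _ N r q))
    (Lp Lm : 'I_N.+1 -> 'I_N.+1 -> {scalar GL r q})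
    (HLp : is_L_functional (fun A B C D => cp * Rmat r q C A D B) Lp)
    (HLm : is_L_functional (fun A B C D => cm * Rinv r q A C B D) Lm) :
  exists (f : Idx N -> Idx N -> {scalar IGL r q})
         (G : bicovariant_bimodule HIGL (Gamma r q)),
    (forall i j a, f i j (IGL_P a) = f_GL HGL Lp Lm i j a) /\
    (forall a g, lact G a g = Gamma_lact a g) /\
    (forall i a, ract G (omega r q i) a
       = \sum_j Gamma_lact (lconv HIGL (f i j) a) (omega r q j)) /\
    (forall a : Idx N -> IGL r q,
       coactL G (\sum_i Gamma_lact (a i) (omega r q i))
       = \sum_i tmul *%R (@Gamma_lact _ N r q) (comul HIGL (a i)) (1 \ox omega r q i)) /\
    (forall a : Idx N -> IGL r q,
       coactR G (\sum_i Gamma_lact (a i) (omega r q i))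
       = \sum_i tmul (@Gamma_lact _ N r q) *%R (comul HIGL (a i))
                  (\sum_j omega r q j \ox M_IGL HIGL j i)).
Proof.
exact: (Gamma_bicovariant_bimodule r_neq0 q_neq0 q_inv q_diag cp_neq0 HGL_std HP HLp HLm).
Qed.
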